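(* Let $n\ge 1$, let $T\in \mathrm{GL}(n,\mathbb{Q})$, and let $\mathcal{C}_{\mathbb{Z}}:=\{A\in \mathrm{GL}(n,\mathbb{Z}) \mid AT=TA\}$. Eigenvalues and Jordan blocks of $T$ are taken over an algebraic closure of $\mathbb{Q}$ (equivalently over $\mathbb{C}$). (a) If $T$ has a unique Jordan block for every eigenvalue, then $\mathcal{C}_{\mathbb{Z}}$ is abelian. (b) If $T$ has two Jordan blocks of the same size for the same eigenvalue, then $\mathcal{C}_{\mathbb{Z}}$ contains a free group on two generators. (c) If, for each eigenvalue, the Jordan blocks of $T$ for that eigenvalue have pairwise different sizes, and at least one eigenvalue has several (at least two) Jordan blocks, then $\mathcal{C}_{\mathbb{Z}}$ is polycyclic.
   Context: A group is polycyclic if it has a finite subnormal series with cyclic factors. The Jordan blocks of $T$ are the blocks, counted with multiplicity, in its Jordan normal form over the algebraic closure. *)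

(* Defs.v *)
From HB Require Import structures.
From mathcomp Require Import all_boot all_order all_fingroup all_algebra all_field.

Set Implicit Arguments.
Unset Strict Implicit.
Unset Printing Implicit Defensive.

Import GroupScope GRing.Theory.
Local Open Scope ring_scope.

Section GeneralLinear.
Variables (R : comUnitRingType) (n : nat).

Record GL := MkGL { GLmx :> 'M[R]_n; GL_unitmx : GLmx \in unitmx }.

HB.instance Definition _ := [isSub for GLmx].
HB.instance Definition _ := [Choice of GL by <:].

Implicit Types A B C : GL.

Fact GL_mul_subproof A B : A *m B \in unitmx.
Proof. by rewrite unitmx_mul !GL_unitmx. Qed.
Fact GL_inv_subproof A : invmx A \in unitmx.
Proof. by rewrite unitmx_inv GL_unitmx. Qed.

Definition GL_one := MkGL (unitmx1 R n).
Definition GL_mul A B := MkGL (GL_mul_subproof A B).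
Definition GL_inv A := MkGL (GL_inv_subproof A).

Fact GL_mulA : associative GL_mul.
Proof. by move=> A B C; apply/val_inj/mulmxA. Qed.
Fact GL_mul1 : left_id GL_one GL_mul.
Proof. by move=> A; apply/val_inj/mul1mx. Qed.
Fact GL_1mul : right_id GL_one GL_mul.
Proof. by move=> A; apply/val_inj/mulmx1. Qed.
Fact GL_mulV : left_inverse GL_one GL_inv GL_mul.
Proof. by move=> A; apply/val_inj/mulVmx/GL_unitmx. Qed.
Fact GL_Vmul : right_inverse GL_one GL_inv GL_mul.
Proof. by move=> A; apply/val_inj/mulmxV/GL_unitmx. Qed.

HB.instance Definition _ :=
  isGroup.Build GL GL_mulA GL_mul1 GL_1mul GL_mulV GL_Vmul.

End GeneralLinear.

Section IntegralCentralizer.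
Variables (n : nat) (T : GL rat n).

Definition commutes_with : {pred GL int n} :=
  fun A => map_mx intr A *m T == T *m map_mx intr A.

Fact commutes_with_group_closed : group_closed commutes_with.
Proof.
split=> [|A B /eqP cA /eqP cB]; apply/eqP; first by rewrite map_mx1 mul1mx mulmx1.
have VB : map_mx intr (invmx B) *m map_mx intr B = 1%:M :> 'M[rat]_n.
  by rewrite -map_mxM mulVmx ?GL_unitmx // map_mx1.
have BV : map_mx intr B *m map_mx intr (invmx B) = 1%:M :> 'M[rat]_n.
  by rewrite -map_mxM mulmxV ?GL_unitmx // map_mx1.
have cV : map_mx intr (invmx B) *m T = T *m map_mx intr (invmx B).
  by rewrite -[LHS]mulmx1 -BV -mulmxA [in LHS](mulmxA T) -cB !mulmxA VB mul1mx.
by rewrite /= map_mxM -mulmxA cV !mulmxA cA.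
Qed.

Definition int_centralizer := {A : GL int n | commutes_with A}.

HB.instance Definition _ := SubChoice.on int_centralizer.
HB.instance Definition _ :=
  SubChoice_isSubGroup.Build (GL int n) commutes_with int_centralizer
    commutes_with_group_closed.

End IntegralCentralizer.

Section JordanForm.
Variable F : fieldType.

Definition jordan_block (a : F) (m : nat) : 'M[F]_m :=
  \matrix_(i, j) (a *+ (i == j) + (i.+1 == j :> nat)%:R).

(* (lam i, sz i), i < k, lists the Jordan blocks of A with multiplicity. *)
Definition jordan_form n (A : 'M[F]_n) k (lam : 'I_k -> F) (sz : 'I_k -> nat) :=
  (forall i, 0 < sz i)%N /\
  exists e : (\sum_i sz i)%N = n,
    similar_in unitmx A
      (castmx (e, e) (\mxdiag_i jordan_block (lam i) (sz i))).

End JordanForm.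

Section Polycyclic.
Local Open Scope group_scope.
Variable G : groupType.
Implicit Types (H K : G -> Prop) (x y g : G).

Definition expgz g (z : int) : G :=
  match z with Posz m => g ^+ m | Negz m => g ^- m.+1 end.

Definition is_subgroup H :=
  [/\ H 1, forall x y, H x -> H y -> H (x * y) & forall x, H x -> H x^-1].

Definition normal_in K H :=
  (forall x, K x -> H x) /\ (forall x y, K x -> H y -> K (x ^ y)).

(* H / K is generated by the coset gK. *)
Definition cyclic_factor H K :=
  exists2 g, H g & forall x, H x -> exists z, K ((expgz g z)^-1 * x).

Definition polycyclic :=
  exists k (H : nat -> G -> Prop),
    [/\ forall x, H 0 x <-> x = 1,
        forall x, H k x,
        forall i, (i <= k)%N -> is_subgroup (H i) &
        forall i, (i < k)%N ->
          normal_in (H i) (H i.+1) /\ cyclic_factor (H i.+1) (H i)].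

End Polycyclic.

Section FreeGroup.
Variable I : choiceType.

(* A letter (i, b) stands for the generator i, or its inverse when b = true. *)
Definition inv_letter (x : I * bool) := (x.1, ~~ x.2).

Definition reduced (w : seq (I * bool)) :=
  sorted (fun x y => y != inv_letter x) w.

Record free_group := FreeWord { word :> seq (I * bool); wordP : reduced word }.

HB.instance Definition _ := [isSub for word].
HB.instance Definition _ := [Choice of free_group by <:].

Definition consr x (w : seq (I * bool)) :=
  if w is y :: w' then if y == inv_letter x then w' else x :: w else [:: x].
Definition mulw u v := foldr consr v u.
Definition invw w := rev (map inv_letter w).

Fact inv_letterK : involutive inv_letter.
Proof. by case=> i b; rewrite /inv_letter /= negbK. Qed.

Fact consr_reduced x w : reduced w -> reduced (consr x w).
Proof.
case: w => [|y w] //= rw; case: ifP => [_|/negbT e /=]; last by rewrite e.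
exact: path_sorted rw.
Qed.

Fact consr_cons x w : reduced (x :: w) -> consr x w = x :: w.
Proof. by case: w => [|y w] //= /andP[/negPf ->]. Qed.

Fact consrK x w : reduced w -> consr (inv_letter x) (consr x w) = w.
Proof.
case: w => [|y w] /= rw; first by rewrite inv_letterK eqxx.
case: ifP => [/eqP e|_]; last by rewrite /= inv_letterK eqxx.
by rewrite -e; apply: consr_cons.
Qed.

Fact consrVK x w : reduced w -> consr x (consr (inv_letter x) w) = w.
Proof. by move/(consrK (inv_letter x)); rewrite inv_letterK. Qed.

Fact mulw_reduced u v : reduced v -> reduced (mulw u v).
Proof. by move=> rv; elim: u => //= x u; apply: consr_reduced. Qed.

Fact mulw_consr x u v : reduced v -> mulw (consr x u) v = consr x (mulw u v).
Proof.
move=> rv; case: u => [|y u] //=; case: ifP => [/eqP->|] //.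
by rewrite consrVK // mulw_reduced.
Qed.

Fact mulwA u v w : reduced w -> mulw u (mulw v w) = mulw (mulw u v) w.
Proof. by move=> rw; elim: u => //= x u ->; rewrite mulw_consr. Qed.

Fact mulw1 u : reduced u -> mulw u [::] = u.
Proof.
elim: u => //= x u IHu rxu.
by rewrite IHu ?consr_cons //; apply: path_sorted rxu.
Qed.

Fact mulVwK u v : reduced v -> mulw (invw u) (mulw u v) = v.
Proof.
move=> rv; elim: u => [|x u IHu] //=.
rewrite /invw /= rev_cons /mulw foldr_rcons consrK //.
exact: mulw_reduced.
Qed.

Fact invw_reduced w : reduced w -> reduced (invw w).
Proof.
rewrite /reduced /invw rev_sorted sorted_map; apply: sub_sorted => x y /=.
by apply: contra => /eqP/(can_inj inv_letterK)->; rewrite ?inv_letterK.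
Qed.

Fact invwK : involutive invw.
Proof.
move=> w; rewrite /invw map_rev revK -map_comp map_id_in // => x _.
exact: inv_letterK.
Qed.

Definition fg_one := @FreeWord [::] isT.
Definition fg_mul (u v : free_group) := FreeWord (mulw_reduced u (wordP v)).
Definition fg_inv (u : free_group) := FreeWord (invw_reduced (wordP u)).

Fact fg_mulA : associative fg_mul.
Proof. by move=> u v w; apply/val_inj/mulwA/wordP. Qed.
Fact fg_mul1 : left_id fg_one fg_mul.
Proof. by move=> u; apply/val_inj. Qed.
Fact fg_1mul : right_id fg_one fg_mul.
Proof. by move=> u; apply/val_inj/mulw1/wordP. Qed.
Fact fg_mulV : left_inverse fg_one fg_inv fg_mul.
Proof.
move=> u; apply/val_inj => /=.
by rewrite -[X in mulw _ X](mulw1 (wordP u)) mulVwK.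
Qed.
Fact fg_Vmul : right_inverse fg_one fg_inv fg_mul.
Proof.
move=> u; rewrite -[X in fg_mul X](_ : fg_inv (fg_inv u) = u) ?fg_mulV //.
by apply/val_inj/invwK.
Qed.

HB.instance Definition _ :=
  isGroup.Build free_group fg_mulA fg_mul1 fg_1mul fg_mulV fg_Vmul.

Definition fg_gen (i : I) : free_group := @FreeWord [:: (i, false)] isT.

Section UniversalProperty.
Local Open Scope group_scope.
Variables (H : groupType) (h : I -> H).

Definition eval_letter (x : I * bool) : H := if x.2 then (h x.1)^-1 else h x.1.
Definition fg_lift (w : free_group) : H :=
  \prod_(x <- word w) eval_letter x.

Fact eval_inv_letter x : eval_letter (inv_letter x) = (eval_letter x)^-1.
Proof. by case: x => i [] //=; rewrite /eval_letter /= invgK. Qed.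

Fact fg_lift_is_multiplicative : {morph fg_lift : u v / u * v}.
Proof.
move=> [u ru] [v rv]; rewrite /fg_lift /= {ru rv}.
elim: u => [|x u IHu] /=; first by rewrite big_nil mul1g.
rewrite big_cons -mulgA -IHu; case: (mulw u v) => [|y w] /=.
  by rewrite big_seq1 big_nil mulg1.
case: ifP => [/eqP->|_]; last by rewrite big_cons.
by rewrite big_cons eval_inv_letter mulVKg.
Qed.

HB.instance Definition _ :=
  isMultiplicative.Build free_group H fg_lift fg_lift_is_multiplicative.

Lemma fg_lift_gen i : fg_lift (fg_gen i) = h i.
Proof. by rewrite /fg_lift /= big_seq1. Qed.

Lemma fg_lift_unique (f : {multiplicative free_group -> H}) :
  (forall i, f (fg_gen i) = h i) -> f =1 fg_lift.
Proof.
move=> fh; have f1 : f 1 = 1.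
  by apply: (@mulgI _ (f 1)); rewrite -gmulfM !mulg1.
have fV u : f u^-1 = (f u)^-1.
  by apply: (@mulgI _ (f u)); rewrite -gmulfM !mulgV.
move=> [u ru]; rewrite /fg_lift /=; elim: u ru => [|x u IHu] ru.
  by rewrite big_nil -f1; congr (f _); apply/val_inj.
have ru' : reduced u by apply: path_sorted ru.
have rx : reduced [:: x] by [].
have -> : FreeWord ru = FreeWord rx * FreeWord ru'.
  by apply/val_inj; rewrite /= consr_cons.
rewrite big_cons gmulfM IHu; congr (_ * _); case: x {ru} rx => i [] rx.
  rewrite /eval_letter /= -fh -fV; congr (f _); exact/val_inj.
by rewrite /eval_letter /= -fh; congr (f _); apply/val_inj.
Qed.

End UniversalProperty.

End FreeGroup.

(* Main.v *)
Require Import Defs.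
From mathcomp Require Import all_boot all_order all_fingroup all_algebra all_field.
From mathcomp Require boolp classical_sets.
From mathcomp Require Import reals Rstruct.
From mathcomp Require Import zify ring.

Set Implicit Arguments.
Unset Strict Implicit.
Unset Printing Implicit Defensive.

Import Order.TTheory GRing.Theory Num.Theory.
Local Open Scope ring_scope.

(** Over the algebraic closure, a matrix commuting with the Jordan form splits into blocks
    intertwining pairs of Jordan blocks; these vanish for distinct eigenvalues and are upper
    triangular Toeplitz otherwise.

    (a) With one block per eigenvalue the commutant is a product of commutants of single
    blocks, which are the polynomials in the block.

    (b) Let [q = p^m], with [p] the minimal polynomial of the eigenvalue [a] and [m] the repeated
    block size.  For rational [f], [w] with [q(T) f = 0] and [w q(T) = 0], the divided difference
    of [q] gives a rational matrix [E(f, w)] commuting with [T] that acts on the eigenvectors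
    [x (q/(X-a))(T)] with rank one.  The pairing [x (q/(X-a))(T) f] has rank at least two, so
    clearing denominators gives two unipotent integer matrices preserving a plane over the
    algebraic closure, where they act as transvections to which ping-pong applies.

    (c) Order the Jordan basis by twice the position in the block minus the block size.  If blocks
    for the same eigenvalue have distinct sizes, every commuting matrix is triangular for this
    weight.  Filtering by how much the nonzero entries raise the weight, the successive
    unipotent quotients embed in quotients of [Z^(n^2)].  The diagonal part is handled as in
    Dirichlet's unit theorem: the logarithms of the absolute values of the diagonal entries form
    a homomorphism to [R^n] with finite balls (up to the kernel), since only finitely many
    integer characteristic polynomials have bounded roots. *)

(** * Polycyclic series *)

Section CyclicChains.
Variable G : groupType.
Implicit Types (H K L : G -> Prop) (v x y : G).
Local Open Scope group_scope.

(** A relative polycyclic series, running from [K] up to the last argument. In this inductive form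
    two series concatenate without reindexing. *)
Inductive cyclic_chain K : (G -> Prop) -> Prop :=
| cyclic_chain0 H : (forall x, H x <-> K x) -> cyclic_chain K H
| cyclic_chainS H K' : cyclic_chain K K' -> is_subgroup H ->
    normal_in K' H -> cyclic_factor H K' -> cyclic_chain K H.

Lemma cyclic_chain_ext K H L :
  (forall x, L x <-> H x) -> cyclic_chain K H -> cyclic_chain K L.
Proof.
move=> eqLH; suff -> : L = H by [].
by apply: boolp.funext => x; apply/boolp.propext.
Qed.

Lemma cyclic_chain_trans K H L :
  cyclic_chain K H -> cyclic_chain H L -> cyclic_chain K L.
Proof.
move=> cKH; elim=> {L} [L eqLH | L H' _ cKH' sL nL fL].
  exact: cyclic_chain_ext cKH.
exact: cyclic_chainS cKH' sL nL fL.
Qed.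

Lemma cyclic_chain_index K L : cyclic_chain K L -> is_subgroup K ->
  exists k (H : nat -> G -> Prop),
    [/\ forall x, H 0%N x <-> K x,
        forall x, H k x <-> L x,
        forall i, (i <= k)%N -> is_subgroup (H i) &
        forall i, (i < k)%N ->
          normal_in (H i) (H i.+1) /\ cyclic_factor (H i.+1) (H i)].
Proof.
move=> cKL sK; elim: cKL => {L} [L eqLK | L H' _ [k [H [H0 Hk sH cH]]] sL nL fL].
  by exists 0%N, (fun=> K); split=> // x; rewrite eqLK.
have eqHk : H k = H' by apply: boolp.funext => x; apply/boolp.propext.
exists k.+1, (fun i => if (i <= k)%N then H i else L).
split=> [x | x | i | i].
- exact: H0.
- by rewrite ltnn.
- by case: (leqP i k) => [le_ik _ | _ _] //; apply: sH.
rewrite ltnS => le_ik; rewrite le_ik; move: le_ik.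
rewrite leq_eqVlt => /predU1P[-> | ltik].
  by rewrite ltnn eqHk.
by rewrite ltik; apply: cH.
Qed.

Lemma cyclic_chain_polycyclic :
  cyclic_chain (fun x => x = 1) (fun=> True) -> polycyclic G.
Proof.
move=> /cyclic_chain_index[|k [H [H0 Hk sH cH]]].
  by split=> [//|x y -> ->|x ->]; rewrite ?mulg1 ?invg1.
by exists k, H; split=> // x; apply/Hk.
Qed.

Lemma expgz_diff v (m p : nat) : expgz v (m%:Z - p%:Z)%R = v ^+ m * v ^- p.
Proof.
case: (leqP p m) => [le_pm | lt_mp]; first by rewrite subzn //= expgnFr.
rewrite -opprB subzn 1?ltnW // -(subnSK lt_mp) -NegzE /= subnSK //.
by rewrite expgnFr 1?ltnW // invgF.
Qed.

Lemma expgzD v (z w : int) : expgz v (z + w)%R = expgz v z * expgz v w.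
Proof.
have int_diff (t : int) : {mp : nat * nat | t = (mp.1%:Z - mp.2%:Z)%R}.
  case: t => m; first by exists (m, 0%N); rewrite subr0.
  by exists (0%N, m.+1); rewrite sub0r.
have [[m p] ->] := int_diff z; have [[m' p'] ->] := int_diff w.
rewrite addrACA -opprD -!PoszD !expgz_diff /= !expgnDr invMg.
have com : commute (v ^- p) (v ^+ m').
  by apply/commute_sym/commuteV/commuteX2/commute_refl.
have com' : commute (v ^- p) (v ^- p').
  by apply/commuteV/commute_sym/commuteV/commuteX2/commute_refl.
by rewrite -com' -!mulgA; congr (_ * _); rewrite !mulgA com.
Qed.

Lemma expgzN v (z : int) : expgz v (- z)%R = (expgz v z)^-1.
Proof. by apply: (mulgI (expgz v z)); rewrite -expgzD subrr mulgV. Qed.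

Lemma subgroup_expgz H v (z : int) : is_subgroup H -> H v -> H (expgz v z).
Proof.
case=> H1 HM HV Hv; have Hexp m : H (v ^+ m).
  by elim: m => [|m IHm] //; rewrite expgS; apply: HM.
by case: z => m; [apply: Hexp | apply/HV/Hexp].
Qed.

(** The union of the cosets [v^z K], which is the subgroup generated by [K] and [v] once [v]
    normalises [K]. *)
Definition adjoin K v x := exists z : int, K ((expgz v z)^-1 * x).

Section Adjoin.
Variables (K H : G -> Prop) (v : G).
Hypotheses (sK : is_subgroup K) (sH : is_subgroup H).
Hypothesis (sKH : forall x, K x -> H x).
Hypothesis (abHK : forall x y, H x -> H y -> K [~ x, y]).
Hypothesis (Hv : H v).

Lemma commg_normal : normal_in K H.
Proof.
have [_ KM _] := sK; split=> // x y Kx Hy.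
by rewrite -(mulVKg x (x ^ y)) -commgEl; apply/KM/abHK/Hy/sKH.
Qed.

Lemma sub_adjoin x : K x -> adjoin K v x.
Proof. by move=> Kx; exists 0%R; rewrite /= invg1 mul1g. Qed.

Lemma mem_adjoin : adjoin K v v.
Proof. by exists 1%R; rewrite /= mulVg; case: sK. Qed.

Lemma adjoin_sub x : adjoin K v x -> H x.
Proof.
have [_ HM _] := sH.
case=> z /sKH Hx; rewrite -(mulVKg (expgz v z) x); apply: HM => //.
exact: subgroup_expgz.
Qed.

Lemma adjoin_subgroup : is_subgroup (adjoin K v).
Proof.
have [K1 KM KV] := sK; have [H1 HM HV] := sH; have [_ nKH] := commg_normal.
have Hz (z : int) : H (expgz v z) by apply: subgroup_expgz.
split=> [|x y [z Kx] [w Ky] | x [z Kx]]; first exact: sub_adjoin.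
  exists (z + w)%R.
  have -> : (expgz v (z + w)%R)^-1 * (x * y) =
      ((expgz v z)^-1 * x) ^ expgz v w * ((expgz v w)^-1 * y).
    by rewrite expgzD conjgE invMg -!mulgA mulVKg.
  by apply: KM => //; apply: nKH.
exists (- z)%R.
have -> : (expgz v (- z)%R)^-1 * x^-1 = ((expgz v z)^-1 * x)^-1 ^ (expgz v z)^-1.
  by rewrite expgzN conjgE invMg !invgK mulgK.
by apply: nKH; [apply: KV | apply: HV].
Qed.

Lemma adjoin_chain : cyclic_chain K (adjoin K v).
Proof.
apply: (cyclic_chainS (K' := K)); first exact: cyclic_chain0.
- exact: adjoin_subgroup.
- split=> [x|x y Kx /adjoin_sub Hy]; first exact: sub_adjoin.
  by have [_] := commg_normal; apply.
- by exists v => //; apply: mem_adjoin.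
Qed.

End Adjoin.

(** Induction on the coset representatives, with [K] growing: a representative in [H] is adjoined to
    [K]; one outside [H] has a coset disjoint from [H], because [K] lies in [H], and is dropped.
    Commutators stay in the larger [K]. *)
Lemma seq_chain K H (s : seq G) : is_subgroup K -> is_subgroup H ->
  (forall x, K x -> H x) -> (forall x y, H x -> H y -> K [~ x, y]) ->
  (forall h, H h -> K h \/ exists2 g, g \in s & K (g^-1 * h)) ->
  cyclic_chain K H.
Proof.
elim: s K => [|g s IHs] K sK sH sKH abHK cov.
  by apply: cyclic_chain0 => h; split=> [/cov[] // [] | /sKH].
case: (boolp.EM (H g)) => [Hg | nHg].
  apply: (cyclic_chain_trans (adjoin_chain sK sH sKH abHK Hg)).
  apply: IHs => [||h|x y Hx Hy|h /cov[Kh|[f]]] //.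
  - exact: adjoin_subgroup sH sKH abHK Hg.
  - exact: adjoin_sub.
  - exact/sub_adjoin/abHK.
  - by left; apply: sub_adjoin.
  rewrite inE => /predU1P[-> Kgh | sf Kfh]; first by left; exists 1%R.
  by right; exists f => //; apply: sub_adjoin.
apply: IHs => // h Hh; have [|[f]] := cov h Hh; first by left.
rewrite inE => /predU1P[-> Kgh | sf Kfh]; last by right; exists f.
have [_ HM HV] := sH.
by case: nHg; rewrite -(invgK g) -(mulgK h g^-1); apply/HV/HM/HV/Hh/sKH.
Qed.

Lemma morph_expgz (V : zmodType) H (f : G -> V) v (z : int) : is_subgroup H ->
  (forall x y, H x -> H y -> f (x * y) = (f x + f y)%R) -> H v ->
  f (expgz v z) = (f v *~ z)%R.
Proof.
move=> sH fM Hv; have [H1 HM HV] := sH.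
have f1 : f 1 = 0%R by apply: (addrI (f 1)); rewrite -fM // mulg1 addr0.
have fV x : H x -> f x^-1 = (- f x)%R.
  by move=> Hx; apply: (addrI (f x)); rewrite -fM ?mulgV ?f1 ?subrr //; apply: HV.
have Hexp m : H (v ^+ m) by apply: (subgroup_expgz m sH Hv).
have fexp m : f (v ^+ m) = (f v *+ m)%R.
  by elim: m => [|m IHm]; rewrite ?f1 // expgS fM // IHm mulrS.
by case: z => m /=; rewrite ?fV // fexp.
Qed.

(** The discreteness argument of Dirichlet's unit theorem, by induction on the number of
    coordinates. If coordinate 0 vanishes on [H] it is discarded; otherwise some [v] with nonzero
    coordinate 0 is adjoined to [K] and the remaining coordinates are projected along [v]. *)
Lemma finite_ball_chain (R : archiRealFieldType) m (L : nat -> G -> R) K H :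
  is_subgroup K -> is_subgroup H ->
  (forall x, K x -> H x) -> (forall x y, H x -> H y -> K [~ x, y]) ->
  (forall i x y, (i < m)%N -> H x -> H y -> L i (x * y) = (L i x + L i y)%R) ->
  (forall i x, (i < m)%N -> K x -> L i x = 0%R) ->
  (forall B : R, exists s : seq G, forall h, H h ->
     (forall i, (i < m)%N -> (`|L i h| <= B)%R) ->
     exists2 g, g \in s & K (g^-1 * h)) ->
  cyclic_chain K H.
Proof.
elim: m L K => [|m IHm] L K sK sH sKH abHK LM LK ball.
  have [s cov] := ball 0%R; apply: (seq_chain (s := s)) => // h Hh.
  by right; apply: cov.
have [[v [Hv /eqP L0v]] | L0] := boolp.EM (exists v, H v /\ L 0%N v <> 0%R); last first.
  apply: (IHm (fun i => L i.+1)) => // [i x y ltim|i x ltim|B].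
  - exact: LM.
  - exact: LK.
  have [s cov] := ball `|B|%R; exists s => h Hh leB; apply: cov => // -[_|i ltim].
    suff ->: L 0%N h = 0%R by rewrite normr0.
    by apply: boolp.contrapT => nz; apply: L0; exists h.
  exact: le_trans (leB i ltim) (ler_norm B).
apply: (cyclic_chain_trans (adjoin_chain sK sH sKH abHK Hv)).
have LX i z : (i < m.+1)%N -> L i (expgz v z) = (L i v *~ z)%R.
  by move=> ltim; apply: morph_expgz sH _ Hv => x y; apply: LM.
have [H1 HM HV] := sH.
have Hz (z : int) : H (expgz v z) by apply: subgroup_expgz.
(* Projection along the vector [L v] onto the coordinates after the first; it kills [v], hence
   vanishes on [adjoin K v]. *)
pose L' i x := (L i.+1 x - L 0%N x / L 0%N v * L i.+1 v)%R.
have L'M i x y : (i < m)%N -> H x -> H y -> L' i (x * y) = (L' i x + L' i y)%R.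
  move=> ltim Hx Hy; rewrite /L' !LM // !mulrDl opprD -!addrA; congr (_ + _)%R.
  by rewrite addrCA.
have L'v i z : (i < m)%N -> L' i (expgz v z) = 0%R.
  by move=> ltim; rewrite /L' !LX // !mulrzAl divff // mul1r subrr.
have nKH : normal_in (adjoin K v) H.
  apply: commg_normal => [|x|x y Hx Hy].
  - exact: adjoin_subgroup sH sKH abHK Hv.
  - exact: adjoin_sub.
  - exact/sub_adjoin/abHK.
apply: (IHm L') => //.
- exact: adjoin_subgroup sH sKH abHK Hv.
- exact: adjoin_sub.
- by move=> x y Hx Hy; apply/sub_adjoin/abHK.
- move=> i x ltim [z Kx]; rewrite -(mulVKg (expgz v z) x) L'M ?L'v //; last exact: sKH.
  by rewrite add0r /L' (LK 0%N _ _ Kx) // (LK i.+1 _ _ Kx) // !mul0r subr0.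
(* Multiplying [h] by a suitable power of [v] brings coordinate 0 below that of [v] in absolute
   value. Every other coordinate is then its projection, at most [B], plus at most that of [v], so
   balls of radius [C] for [L] serve for [L']. *)
move=> B; pose C := (`|B| + \sum_(i < m.+1) `|L i v|)%R.
have [s cov] := ball C; exists s => h Hh leB.
pose z := Num.floor (L 0%N h / L 0%N v)%R.
have Hh' : H ((expgz v z)^-1 * h) by apply: HM => //; apply: HV.
have eqL i : (i < m.+1)%N -> L i ((expgz v z)^-1 * h) = (L i h - L i v *~ z)%R.
  by move=> ltim; rewrite -expgzN LM // LX // mulrNz addrC.
have ltL0 : (`|L 0%N ((expgz v z)^-1 * h)%g / L 0%N v| <= 1)%R.
  rewrite eqL // mulrBl mulrzAl divff //.
  have /andP[le_z lt_z] := floor_itv (L 0%N h / L 0%N v)%R.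
  rewrite ger0_norm ?subr_ge0 // lerBlDl.
  by apply: ltW; move: lt_z; rewrite -/z intrD.
have leC i : (i < m.+1)%N -> (`|L i v| <= \sum_(i < m.+1) `|L i v|)%R.
  move=> ltim; rewrite (bigD1 (Ordinal ltim)) //= lerDl.
  by apply: sumr_ge0 => j _.
have [|g sg Kgh] := cov _ Hh'.
  case=> [_|i ltim].
    rewrite -(divfK L0v (L 0%N ((expgz v z)^-1 * h))) normrM.
    apply: le_trans (ler_piMl _ ltL0) _ => //.
    by apply: le_trans (leC 0%N _) _; rewrite // lerDr.
  have -> : L i.+1 ((expgz v z)^-1 * h) =
     (L' i h + L 0%N ((expgz v z)^-1 * h)%g / L 0%N v * L i.+1 v)%R.
    have : L' i ((expgz v z)^-1 * h) = L' i h.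
      by rewrite -expgzN L'M // L'v // add0r.
    by move=> <-; rewrite subrK.
  apply: le_trans (ler_normD _ _) _; apply: lerD.
    exact: le_trans (leB i ltim) (ler_norm B).
  rewrite normrM; apply: le_trans (leC i.+1 _) => //.
  by rewrite ler_piMl.
exists g => //.
have Hg : H g.
  rewrite -(invgK g) -(mulgK ((expgz v z)^-1 * h) g^-1).
  by apply/HV/HM; [apply: sKH | apply: HV].
have [_ KM _] := adjoin_subgroup sK sH sKH abHK Hv.
have -> : g^-1 * h = expgz v z ^ g * (g^-1 * ((expgz v z)^-1 * h)).
  by rewrite conjgE -!mulgA mulVKg mulVKg.
apply: KM; last exact: sub_adjoin.
apply: nKH.2 => //; exists z; rewrite mulVg; by case: sK.
Qed.

(** The generator is the least positive element of [P], or 0 if there is none; remainders modulo it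
    stay in [P], so they vanish. *)
Lemma int_ideal_principal (P : int -> Prop) :
  P 0%R -> (forall a b, P a -> P b -> P (a - b)%R) ->
  exists2 d, P d & forall c, P c -> exists z, c = (d * z)%R.
Proof.
move=> P0 PB; have PN a : P a -> P (- a)%R by move=> Pa; rewrite -sub0r; apply: PB.
have PD a b : P a -> P b -> P (a + b)%R.
  by move=> Pa /PN Pb; rewrite -[b]opprK; apply: PB.
have PM a z : P a -> P (a * z)%R.
  move=> Pa; elim: z => [|m IHm|m IHm]; first by rewrite mulr0.
    by rewrite -addn1 PoszD mulrDr mulr1; apply: PD.
  by rewrite -addn1 PoszD opprD mulrDr mulrN1; apply: PB.
have [[m Pm] | nP] := boolp.EM (exists m, boolp.asbool (P m.+1%:Z)); last first.
  exists 0%R => // c Pc; exists 0%R; rewrite mul0r.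
  case: c Pc => [[|m]|m] // Pc; case: nP; exists m; apply/boolp.asboolP => //.
  by move/PN: Pc.
have ex : exists m, boolp.asbool (P m.+1%:Z) by exists m.
case: (ex_minnP ex) => d /boolp.asboolP Pd min_d.
exists d.+1%:Z => // c Pc; exists (c %/ d.+1)%Z.
have Pmod : P (c %% d.+1)%Z.
  by rewrite /modz mulrC; apply: PB => //; apply: PM.
have: (c %% d.+1)%Z = `|(c %% d.+1)%Z|%N by rewrite gez0_abs ?modz_ge0.
case: (absz _) => [mod0 | r eq_r].
  by rewrite {1}(divz_eq c d.+1) mod0 addr0 mulrC.
have lt_r : (r < d)%N by rewrite -ltnS -ltz_nat -eq_r ltz_pmod.
by move/boolp.asboolP/min_d: (eq_ind _ P Pmod _ eq_r); rewrite leqNgt lt_r.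
Qed.

(** The recursion exposes the coefficient of the first generator, which is what the induction
    building a series splits off. *)
Fixpoint int_span (V : zmodType) (e : seq V) (w : V) : Prop :=
  if e is a :: e' then exists c : int, int_span e' (w - a *~ c)%R else w = 0%R.

Lemma int_spanB (V : zmodType) (e : seq V) (w w' : V) :
  int_span e w -> int_span e w' -> int_span e (w - w')%R.
Proof.
elim: e w w' => [|a e IHe] w w' /=; first by move=> -> ->; rewrite subr0.
move=> [c sw] [c' sw']; exists (c - c')%R.
suff -> : (w - w' - a *~ (c - c') = (w - a *~ c) - (w' - a *~ c'))%R by apply: IHe.
by rewrite mulrzBr !opprB addrACA [RHS]addrACA [(- w' + _)%R]addrC.
Qed.

Lemma int_span0 (V : zmodType) (e : seq V) : int_span e 0%R.
Proof.
by elim: e => //= a e IHe; exists 0%R; rewrite mulr0z subr0.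
Qed.

(** The quotient of [H] by the kernel of [f] embeds in a finitely generated abelian group. The
    elements whose image needs only the generators after [a] form a subgroup [H'], and [H] modulo
    [H'] is cyclic because the coefficients of [a] form an ideal of the integers. *)
Lemma int_span_chain (V : zmodType) (e : seq V) (f : G -> V) H :
  is_subgroup H ->
  (forall x y, H x -> H y -> f (x * y) = (f x + f y)%R) ->
  (forall x, H x -> int_span e (f x)) ->
  cyclic_chain (fun x => H x /\ f x = 0%R) H.
Proof.
elim: e H => [|a e IHe] H sH fM spf.
  by apply: cyclic_chain0 => x; split=> [Hx|[]] //; split=> //; apply: spf.
have [H1 HM HV] := sH.
have fX x (z : int) : H x -> f (expgz x z) = (f x *~ z)%R by apply: morph_expgz.
have fV x : H x -> f x^-1 = (- f x)%R.
  by move=> Hx; have := fX x (-1)%R Hx; rewrite /= expg1 mulrN1z.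
pose H' x := H x /\ int_span e (f x).
have f1 : f 1 = 0%R by have := fX 1 0%R H1; rewrite /= expg0 mulr0z.
have sB w w' : int_span e w -> int_span e w' -> int_span e (w - w')%R.
  exact: int_spanB.
have sH' : is_subgroup H'.
  split=> [|x y [Hx sx] [Hy sy] | x [Hx sx]].
  - by split; rewrite // f1; apply: int_span0.
  - split; first exact: HM.
    rewrite fM // -[f y]opprK; apply: (sB) => //; rewrite -[X in int_span _ X]add0r.
    by apply: sB => //; apply: int_span0.
  - split; first exact: HV.
    by rewrite fV // -[X in int_span _ X]add0r; apply: sB => //; apply: int_span0.
have cKH' : cyclic_chain (fun x => H x /\ f x = 0%R) H'.
  have -> : (fun x => H x /\ f x = 0%R) = (fun x => H' x /\ f x = 0%R).
    apply: boolp.funext => x; apply/boolp.propext; split=> [[Hx fx]|[[Hx _] fx]] //.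
    by split=> //; split=> //; rewrite fx; apply: int_span0.
  by apply: IHe => // [x y [Hx _] [Hy _] | x []] //; apply: fM.
apply: (cyclic_chainS cKH' sH).
  split=> [x [] //|x y [Hx sx] Hy]; split.
    by rewrite conjgE; apply: (HM); [apply: HV | apply: HM].
  rewrite conjgE fM ?fV ?fM //; do ?[exact: HM | exact: HV].
  by rewrite addrC addrK.
(* The generators may be dependent, so a coefficient of [a] is not determined by [x]; [P] collects
   all coefficients that some expression allows. *)
pose P (c : int) := exists2 x, H x & int_span e (f x - a *~ c)%R.
have [||d [v Hv sv] dP] := @int_ideal_principal P.
- by exists 1 => //; rewrite f1 mulr0z subr0; apply: int_span0.
- move=> c c' [x Hx sx] [y Hy sy]; exists (x * y^-1); first by apply: HM => //; apply: HV.
  rewrite fM ?fV //; last exact: HV.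
  suff -> : (f x - f y - a *~ (c - c') = (f x - a *~ c) - (f y - a *~ c'))%R by apply: sB.
  by rewrite mulrzBr !opprB addrACA [RHS]addrACA [(- f y + _)%R]addrC.
exists v => // x Hx; have [c sx] := spf x Hx.
have [z eq_c] : exists z, c = (d * z)%R by apply: dP; exists x.
exists z; have Hvz : H (expgz v z) by apply: subgroup_expgz.
split; first by apply: HM => //; apply: HV.
rewrite fM ?fV ?fX //; last exact: HV.
have sX w : int_span e w -> int_span e (w *~ z)%R.
  move=> sw; have sN w' : int_span e w' -> int_span e (- w')%R.
    by rewrite -(sub0r w'); apply/sB/int_span0.
  have sXn m : int_span e (w *+ m)%R.
    elim: m => [|m IHm]; first exact: int_span0.
    by rewrite mulrS -[(w *+ m)%R]opprK; apply: sB => //; apply: sN.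
  by case: (z) => m; [apply: sXn | apply/sN/sXn].
rewrite addrC -(subrK (a *~ c)%R (f x)) -addrA {2}eq_c mulrzA -mulrzBl.
by rewrite -[(a *~ d - _)%R]opprB mulNrz; apply/sB/sX.
Qed.

End CyclicChains.

(** * Logarithms over an archimedean field *)

Section BinaryLog.
Variables (F : archiRealFieldType) (R : realType).
Implicit Types x y : F.

(** A Dedekind cut for the binary logarithm: the fractions [p / q] with [2^p <= x^q]. Only integer
    powers in [F] occur, so [F] may be the real algebraic numbers while the logarithm lies in
    [R]. *)
Definition log2_cut x : classical_sets.set R := fun r =>
  exists (p : int) (q : nat), r = p%:~R / q.+1%:R /\ 2%:R ^ p <= x ^+ q.+1.

Definition log2 x : R := sup (log2_cut x).

Lemma ratio_leP (p p' : int) (q q' : nat) :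
  (p%:~R / q.+1%:R <= p'%:~R / q'.+1%:R :> R) = (p * q'.+1%:Z <= p' * q.+1%:Z).
Proof.
rewrite ler_pdivlMr ?ltr0n // mulrAC ler_pdivrMr ?ltr0n //.
by rewrite -[q.+1%:R]/(q.+1%:~R) -[q'.+1%:R]/(q'.+1%:~R) -!intrM ler_int.
Qed.

Lemma log2_cut_has_sup x : 0 < x -> classical_sets.has_sup (log2_cut x).
Proof.
move=> x_gt0; split.
  pose N := Num.bound x^-1; exists ((- N%:Z)%:~R / 1%:R), (- N%:Z), 0%N.
  split=> //; rewrite expr1 -invr_expz -[x]invrK lef_pV2 ?posrE ?invr_gt0 ?exprz_gt0 //.
  by apply/ltW/upper_nthrootP.
pose M := Num.bound x; exists (M%:Z%:~R / 1%:R) => _ [p [q [-> le_px]]].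
rewrite ratio_leP mulr1 -(ler_eXz2l (x := 2%:R : F)) ?ltr1n //.
apply: le_trans le_px _; rewrite -PoszM -exprnP exprM.
by apply: lerXn2r; rewrite ?nnegrE ?exprn_ge0 ?ler0n ?ltW // upper_nthrootP.
Qed.

Lemma log2_cutD x y a b : 0 < x -> 0 < y ->
  log2_cut x a -> log2_cut y b -> log2_cut (x * y) (a + b).
Proof.
move=> x_gt0 y_gt0 [p [q [-> lep]]] [p' [q' [-> lep']]].
exists (p * q'.+1%:Z + p' * q.+1%:Z), (q.+1 * q'.+1).-1; rewrite prednK //; split.
  by rewrite addf_div ?pnatr_eq0 // intrD !intrM natrM.
have two0 : 2%:R != 0 :> F by rewrite pnatr_eq0.
have X_ge0 z : 0 <= (2%:R : F) ^ z by rewrite exprz_ge0 ?ler0n.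
rewrite expfzDr // -!exprz_exp -!exprnP exprMn {2}[(q.+1 * _)%N]mulnC !exprM.
apply: ler_pM; rewrite ?exprn_ge0 //; apply: lerXn2r => //;
  by rewrite nnegrE ?X_ge0 ?exprn_ge0 ?(ltW x_gt0) ?(ltW y_gt0).
Qed.

Lemma log2_ub x a : 0 < x -> log2_cut x a -> a <= log2 x.
Proof. by move=> x_gt0 xa; have := sup_upper_bound (log2_cut_has_sup x_gt0); apply. Qed.

Lemma log2_le x b : 0 < x -> (forall a, log2_cut x a -> a <= b) -> log2 x <= b.
Proof. by move=> /log2_cut_has_sup[ne _] ub; apply: ge_sup. Qed.

Lemma log2_superadditive x y : 0 < x -> 0 < y -> log2 x + log2 y <= log2 (x * y).
Proof.
move=> x_gt0 y_gt0; rewrite -lerBrDr; apply: log2_le => // a xa.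
rewrite lerBrDr addrC -lerBrDr; apply: log2_le => // b yb.
by rewrite lerBrDr addrC; apply: log2_ub; rewrite ?mulr_gt0 //; apply: log2_cutD.
Qed.

(** Otherwise a rational [p / q] lies strictly between [log2 x] and [- log2 x^-1]. Comparing [2^p]
    with [x^q] puts either [p / q] in the cut of [x] or [- p / q] in the cut of [x^-1], and both are
    too large. *)
Lemma log2V_ge x : 0 < x -> - log2 x <= log2 x^-1.
Proof.
move=> x_gt0; rewrite leNgt; apply/negP; rewrite ltrNr => /rat_in_itvoo[r].
rewrite in_itv /= => /andP[lt_xr lt_rx].
have eq_r : ratr r = (numq r)%:~R / `|denq r|.-1.+1%:R :> R.
  by rewrite prednK ?absz_gt0 // natr_absz ger0_norm.
set p := numq r in eq_r; set q := `|denq r|.-1 in eq_r.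
have [le_px | lt_xp] := leP (2%:R ^ p) (x ^+ q.+1).
  suff: ratr r <= log2 x by rewrite leNgt lt_xr.
  by apply: log2_ub => //; exists p, q.
suff: - ratr r <= log2 x^-1 by rewrite lerNl leNgt lt_rx.
apply: log2_ub; first by rewrite invr_gt0.
exists (- p), q; split; first by rewrite eq_r mulrNz mulNr.
by rewrite -invr_expz exprVn lef_pV2 ?posrE ?exprz_gt0 ?exprn_gt0 // ltW.
Qed.

Lemma log2M x y : 0 < x -> 0 < y -> log2 (x * y) = log2 x + log2 y.
Proof.
move=> x_gt0 y_gt0; apply/le_anti; rewrite log2_superadditive // andbT.
have xy_gt0 : 0 < x * y by rewrite mulr_gt0.
have Vy_gt0 : 0 < y^-1 by rewrite invr_gt0.
have := log2_superadditive xy_gt0 Vy_gt0.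
rewrite mulfK ?gt_eqF // -lerBrDr => /le_trans-> //.
by rewrite lerD2l lerNl log2V_ge.
Qed.

Lemma log2_bound x (B : nat) : 0 < x -> log2 x <= B%:R -> x <= 2%:R ^+ B.+1.
Proof.
move=> x_gt0 leB; rewrite leNgt; apply/negP => /ltW lt_Bx.
have: B.+1%:R / 1%:R <= log2 x by apply: log2_ub => //; exists B.+1, 0%N.
by rewrite divr1 => /le_trans/(_ leB); rewrite ler_nat ltnn.
Qed.

End BinaryLog.

(** * Jordan blocks *)

Section Intertwiners.
Variable F : fieldType.
Implicit Types (a b : F) (m : nat).

(** Entries at natural indices, padded by zero, so that the shifted indices in the recurrences need
    no bound proofs. *)
Definition mxnth m1 m2 (X : 'M[F]_(m1, m2)) (l t : nat) : F :=
  if insub l is Some i then if insub t is Some j then X i j else 0 else 0.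

Lemma mxnthE m1 m2 (X : 'M[F]_(m1, m2)) (i : 'I_m1) (j : 'I_m2) :
  mxnth X i j = X i j.
Proof. by rewrite /mxnth !valK. Qed.

Lemma mxnth_geml m1 m2 (X : 'M[F]_(m1, m2)) l t : (m1 <= l)%N -> mxnth X l t = 0.
Proof. by move=> le_ml; rewrite /mxnth insubN // -leqNgt. Qed.

Lemma mxnth_gemr m1 m2 (X : 'M[F]_(m1, m2)) l t : (m2 <= t)%N -> mxnth X l t = 0.
Proof.
by move=> le_mt; rewrite /mxnth; case: insub => // i; rewrite insubN // -leqNgt.
Qed.

Lemma mul_jordan_blockl m1 m2 a (X : 'M[F]_(m1, m2)) i j :
  (jordan_block a m1 *m X) i j = a * X i j + mxnth X i.+1 j.
Proof.
rewrite mxE; under eq_bigr do rewrite mxE mulrDl.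
rewrite big_split /=; congr (_ + _).
  rewrite (bigD1 i) //= eqxx mulr1n big1 ?addr0 // => s /negPf ne_si.
  by rewrite eq_sym ne_si mulr0n mul0r.
have [lt_im | le_mi] := ltnP i.+1 m1.
  rewrite (bigD1 (Ordinal lt_im)) //= eqxx mul1r big1 ?addr0.
    by rewrite -(mxnthE X (Ordinal lt_im)).
  move=> s /eqP ne_s; case: eqP => [eq_s|]; last by rewrite mul0r.
  by case: ne_s; apply: val_inj; rewrite /= eq_s.
rewrite mxnth_geml // big1 // => s _; case: eqP => [eq_s|]; last by rewrite mul0r.
by move: (ltn_ord s); rewrite -eq_s ltnNge le_mi.
Qed.

Lemma mul_jordan_blockr m1 m2 a (X : 'M[F]_(m1, m2)) i j :
  (X *m jordan_block a m2) i j =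
    a * X i j + (if j : nat is t.+1 then mxnth X i t else 0).
Proof.
rewrite mxE; under eq_bigr do rewrite mxE mulrDr.
rewrite big_split /=; congr (_ + _).
  rewrite (bigD1 j) //= eqxx mulr1n big1 ?addr0 1?mulrC // => s /negPf ne_sj.
  by rewrite ne_sj mulr0n mulr0.
case: j => -[|t] lt_j /=; first by rewrite big1 // => s _; rewrite mulr0.
rewrite (bigD1 (Ordinal (ltnW lt_j))) //= eqxx mulr1 big1 ?addr0.
  by rewrite -(mxnthE X _ (Ordinal (ltnW lt_j))).
move=> s /eqP ne_s; rewrite eqSS; case: eqP => [eq_s|]; last by rewrite mulr0.
by case: ne_s; apply: val_inj.
Qed.

Section Recurrence.
Variables (m1 m2 : nat) (a b : F) (X : 'M[F]_(m1, m2)).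
Hypothesis intX : jordan_block a m1 *m X = X *m jordan_block b m2.

Lemma intertwiner_rec l t : (l < m1)%N -> (t < m2)%N ->
  a * mxnth X l t + mxnth X l.+1 t =
  b * mxnth X l t + (if t is t'.+1 then mxnth X l t' else 0).
Proof.
move=> lt_l lt_t; have /matrixP/(_ (Ordinal lt_l) (Ordinal lt_t)) := intX.
by rewrite mul_jordan_blockl mul_jordan_blockr -mxnthE.
Qed.

(** The recurrence writes [a - b] times an entry in terms of the entries just below and just to the
    left, so vanishing spreads from the lower left corner by induction on [m1 - l + t]. *)
Lemma intertwiner_eq0 : a != b -> X = 0.
Proof.
move=> ne_ab; apply/matrixP => i j; rewrite mxE -mxnthE.
move: (leqnn (m1 - i + j)).
elim: {i j}(_ + _)%N {-2}(i : nat) {-2}(j : nat) => [|k IHk] l t le_k.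
  by rewrite mxnth_geml //; lia.
have [le_ml | lt_lm] := leqP m1 l; first exact: mxnth_geml.
have [lt_t | le_mt] := ltnP t m2; last exact: mxnth_gemr.
have := intertwiner_rec lt_lm lt_t; rewrite (IHk l.+1); last by lia.
have -> : (if t is t'.+1 then mxnth X l t' else 0) = 0.
  by case: t le_k {lt_t} => // t le_k; apply: IHk; lia.
rewrite !addr0 => /eqP; rewrite -subr_eq0 -mulrBl mulf_eq0 subr_eq0 (negPf ne_ab).
by move/eqP.
Qed.

Hypothesis eq_ab : a = b.

Lemma intertwiner_rec0 l : (l < m1)%N -> mxnth X l.+1 0 = 0.
Proof.
move=> lt_l; have [lt0m | ] := posnP m2; last first.
  by move=> lt_0m; have := intertwiner_rec lt_l lt_0m; rewrite eq_ab => /addrI.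
by rewrite mxnth_gemr ?lt0m.
Qed.

Lemma intertwiner_recS l t : (l < m1)%N -> (t.+1 < m2)%N ->
  mxnth X l.+1 t.+1 = mxnth X l t.
Proof.
by move=> lt_l lt_t; have := intertwiner_rec lt_l lt_t; rewrite eq_ab => /addrI.
Qed.

(* Entries are constant along diagonals, and a diagonal vanishes if it starts
   below the first row or ends before the last column. *)
Lemma intertwiner_supp i j : X i j != 0 ->
  (i <= j)%N && (i + m2 <= j + m1)%N.
Proof.
rewrite -mxnthE => nzX; apply/andP; split.
  rewrite leqNgt; apply: contra nzX => lt_ji; apply/eqP.
  have: (j < m2)%N by []. have : (i < m1)%N by [].
  elim: {i j} (j : nat) (i : nat) lt_ji => [|t IHt] [|l] //= lt_tl lt_l lt_t.
    exact/intertwiner_rec0/ltnW.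
  by rewrite intertwiner_recS ?IHt // ltnW.
rewrite leqNgt; apply: contra nzX => lt_ji; apply/eqP.
suff claim k l t : (m1 - l = k)%N -> (k < m2 - t)%N -> mxnth X l t = 0.
  by apply: (claim _ i j erefl); have := ltn_ord i; have := ltn_ord j; lia.
elim: k l t => [|k IHk] l t eq_k lt_k; first by rewrite mxnth_geml //; lia.
have [lt_l lt_t] : (l < m1)%N /\ (t.+1 < m2)%N by lia.
by rewrite -intertwiner_recS // IHk //; lia.
Qed.

End Recurrence.

Lemma jordan_block_diag a m : jordan_block a m = a%:M + jordan_block 0 m.
Proof. by apply/matrixP => i j; rewrite !mxE mul0rn add0r. Qed.

Lemma row0_jordan_block_exp m (t : 'I_m.+1) :
  delta_mx 0 0 *m jordan_block 0 m.+1 ^+ t = delta_mx 0 t :> 'rV[F]_m.+1.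
Proof.
case: t => t; elim: t => [|t IHt] lt_t.
  by rewrite expr0 mulmx1; congr delta_mx; apply: val_inj.
rewrite exprSr mulmxA (IHt (ltnW lt_t)); apply/matrixP => i j.
rewrite mul_jordan_blockr mul0r add0r mxE (ord1 i) eqxx /=.
case: j => -[|s] lt_s; first by rewrite -val_eqE.
pose d : 'rV[F]_m.+1 := delta_mx 0 (Ordinal (ltnW lt_t)).
rewrite -[LHS]/(mxnth d (ord0 : 'I_1) (Ordinal (ltnW lt_s))) mxnthE.
by rewrite mxE -!val_eqE.
Qed.

(** Each basis row is the first one times a power of the nilpotent block, so a commuting matrix is
    determined by its first row. *)
Lemma jordan_commutant_eq0 m a (X : 'M[F]_m.+1) :
  jordan_block a m.+1 *m X = X *m jordan_block a m.+1 ->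
  delta_mx 0 0 *m X = 0 :> 'rV_m.+1 -> X = 0.
Proof.
move=> cX X0; have cN : jordan_block 0 m.+1 *m X = X *m jordan_block 0 m.+1.
  move: cX; rewrite jordan_block_diag mulmxDl mulmxDr scalar_mxC.
  exact: addrI.
apply/row_matrixP => i; rewrite row0 rowE -row0_jordan_block_exp -mulmxA.
have cNi k : jordan_block 0 m.+1 ^+ k *m X = X *m jordan_block 0 m.+1 ^+ k.
  elim: k => [|k IHk]; first by rewrite expr0 mulmx1 mul1mx.
  by rewrite exprSr -mulmxA cN mulmxA IHk -mulmxA.
by rewrite cNi mulmxA X0 mul0mx.
Qed.

(** The polynomial [Q] in the nilpotent block whose coefficients are the first row of [X] has the
    same first row as [X], so [X = Q], and a polynomial in the block commutes with whatever the
    block commutes with. *)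
Lemma jordan_commutant_comm m a (X Y : 'M[F]_m) :
  jordan_block a m *m X = X *m jordan_block a m ->
  jordan_block a m *m Y = Y *m jordan_block a m -> X *m Y = Y *m X.
Proof.
case: m X Y => [|m] X Y cX cY; first by apply/matrixP => -[].
pose N : 'M[F]_m.+1 := jordan_block 0 m.+1.
have cN (Z : 'M_m.+1) : jordan_block a m.+1 *m Z = Z *m jordan_block a m.+1 <->
    GRing.comm N Z.
  rewrite jordan_block_diag mulmxDl mulmxDr scalar_mxC.
  by split=> [/addrI | cNZ] //; congr (_ + _); exact: cNZ.
pose Q := \sum_(t < m.+1) X 0 t *: N ^+ t.
have cQ Z : GRing.comm N Z -> GRing.comm Q Z.
  move=> cZ; apply/commr_sym/commr_sum => t _; rewrite /GRing.comm.
  rewrite -scalerAl -scalerAr; congr (_ *: _).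
  exact/commrX/commr_sym.
suff eqXQ : X = Q.
  by rewrite eqXQ; apply: cQ; apply/cN.
apply/eqP; rewrite -subr_eq0; apply/eqP/(@jordan_commutant_eq0 _ a).
  apply/cN; apply: commrB; first exact/cN.
  exact/commr_sym/cQ.
rewrite mulmxBr mulmx_sumr -rowE; apply/eqP; rewrite subr_eq0; apply/eqP.
rewrite {1}[row 0 X]row_sum_delta; apply: eq_bigr => t _.
by rewrite -scalemxAr row0_jordan_block_exp mxE.
Qed.

End Intertwiners.

(** * Matrices commuting with a Jordan matrix *)

Section JordanCommutant.
Variables (F : fieldType) (k : nat) (lam : 'I_k -> F) (sz : 'I_k -> nat).
Local Notation N := (\sum_i sz i)%N.
Local Notation J := (\mxdiag_i jordan_block (lam i) (sz i)).
Implicit Types X Y : 'M[F]_N.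

Lemma submxblock_intertwiner X i j : J *m X = X *m J ->
  jordan_block (lam i) (sz i) *m submxblock X i j =
  submxblock X i j *m jordan_block (lam j) (sz j).
Proof.
move=> cX; move: i j; apply/eq_mxblockP.
by rewrite -mul_mxdiag_mxblock -mul_mxblock_mxdiag submxblockK.
Qed.

Lemma simple_jordan_commutant_comm X Y : injective lam ->
  J *m X = X *m J -> J *m Y = Y *m J -> X *m Y = Y *m X.
Proof.
move=> inj_lam.
have diagE Z : J *m Z = Z *m J -> Z = \mxdiag_i submxblock Z i i.
  move=> cZ; apply/mxblockP => i j; rewrite mxblockK.
  case: eqP => [<-|/eqP ne_ij]; first by rewrite conform_mx_id.
  apply: (intertwiner_eq0 (submxblock_intertwiner i j cZ)).
  by rewrite (inj_eq inj_lam).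
have mulE (B C : forall i, 'M[F]_(sz i)) :
    \mxdiag_i B i *m \mxdiag_i C i = \mxdiag_i (B i *m C i).
  rewrite [X in _ *m X]/mxdiag mul_mxdiag_mxblock; apply/eq_mxblockP => i j.
  by case: eqP => [<-|_]; rewrite ?conform_mx_id ?mulmx0.
move=> cX cY; rewrite (diagE X) // (diagE Y) // !mulE; apply/eq_mxdiagP => i.
by apply: jordan_commutant_comm (lam i) _ _ _ _; apply: submxblock_intertwiner.
Qed.

(* Twice the position in the block minus the block size: the weight for the
   [sl_2]-triple completing the nilpotent part, shifted to be nonnegative. *)
Definition jordan_weight (a : 'I_N) : nat :=
  2 * tagnat.sig2 a + (N - sz (tagnat.sig1 a)).

(** Adding the two inequalities of [intertwiner_supp] compares the weights. Equality requires equal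
    positions and equal block sizes, hence, under the assumption on sizes, the same block and the
    same index. *)
Lemma jordan_commutant_weight X a b :
  (forall i j, i != j -> lam i = lam j -> sz i <> sz j) ->
  J *m X = X *m J -> X a b != 0 ->
  a = b \/ (jordan_weight a < jordan_weight b)%N.
Proof.
move=> ne_sz cX nzX.
have nzXij : submxblock X (tagnat.sig1 a) (tagnat.sig1 b)
    (tagnat.sig2 a) (tagnat.sig2 b) != 0 by rewrite mxE !tagnat.sig2K.
have intX := submxblock_intertwiner (tagnat.sig1 a) (tagnat.sig1 b) cX.
have eq_lam : lam (tagnat.sig1 a) = lam (tagnat.sig1 b).
  by apply/eqP/(contraNT _ nzXij) => ne_lam; rewrite (intertwiner_eq0 intX) ?mxE.
have /andP[le_ab le_sz] := intertwiner_supp intX eq_lam nzXij.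
have le_szN s : (sz s <= N)%N by rewrite (bigD1 s) //= leq_addr.
have le_aN := le_szN (tagnat.sig1 a); have le_bN := le_szN (tagnat.sig1 b).
rewrite /jordan_weight.
have [eq_ij | /ne_sz/(_ eq_lam)] := eqVneq (tagnat.sig1 a) (tagnat.sig1 b).
  have eq_sz : sz (tagnat.sig1 a) = sz (tagnat.sig1 b) by rewrite eq_ij.
  have [lt_ab | le_ba] := ltnP (tagnat.sig2 a) (tagnat.sig2 b); first by right; lia.
  left; rewrite -(tagnat.sig2K a) -(tagnat.sig2K b); apply/val_inj/eqP => /=.
  by rewrite tagnat.eq_Rank eqn_leq le_ab le_ba !andbT; apply/eqP.
by right; lia.
Qed.

End JordanCommutant.

(** * Integer matrix groups triangular in some basis *)

Lemma finite_image_seq (G : choiceType) (fT : finType) (f : G -> fT)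
    (P : G -> Prop) :
  exists s : seq G, forall h, P h -> exists g, [/\ g \in s, P g & f g = f h].
Proof.
suff [s sP] : exists s : seq G, forall h, P h -> f h \in enum fT ->
    exists g, [/\ g \in s, P g & f g = f h].
  by exists s => h Ph; apply: sP => //; rewrite mem_enum.
elim: (enum fT) => [|t e [s sP]]; first by exists [::].
have [[g [Pg fg]] | nP] := boolp.EM (exists g, P g /\ f g = t).
  exists (g :: s) => h Ph; rewrite inE => /predU1P[-> | eh].
    by exists g; rewrite mem_head.
  by have [g' [sg' Pg' fg']] := sP h Ph eh; exists g'; rewrite inE sg' orbT.
exists s => h Ph; rewrite inE => /predU1P[fh | eh]; last exact: sP.
by case: nP; exists h.
Qed.

Lemma coef_prod_XsubC_bounded (R : numDomainType) (n C : nat) :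
  exists D : nat, forall s : seq R, size s = n ->
    (forall c, c \in s -> `|c| <= C%:R) ->
    forall i, `|(\prod_(c <- s) ('X - c%:P))`_i| <= D%:R.
Proof.
elim: n => [|n [D boundD]].
  exists 1%N => s /size0nil-> _ i; rewrite big_nil coef1.
  by case: (i == 0)%N; rewrite ?normr1 ?normr0 ?ler01.
exists (D + C * D)%N => -[|c s] //= [size_s] boundC i.
have boundDs : forall i, `|(\prod_(c <- s) ('X - c%:P))`_i| <= D%:R.
  by apply: boundD => // c' sc'; apply: boundC; rewrite inE sc' orbT.
rewrite big_cons mulrBl coefB coefXM coefCM natrD natrM.
apply: le_trans (ler_normB _ _) _; apply: lerD.
  by case: (i == 0)%N; rewrite ?normr0 ?ler0n.
by rewrite normrM; apply: ler_pM => //; apply: boundC; rewrite mem_head.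
Qed.

(** Kronecker's finiteness: coefficients in [[-D, D]], shifted by [D] into an ordinal type, leave
    finitely many polynomials, and the roots of all of them are concatenated. *)
Lemma bounded_int_poly_roots (n D : nat) : exists rs : seq algC,
  forall p : {poly int}, p != 0 -> (size p <= n)%N ->
    (forall i, (`|(p`_i)%R| <= D)%N) ->
    forall x : algC, root (map_poly intr p) x -> x \in rs.
Proof.
pose polyf (f : {ffun 'I_n -> 'I_(2 * D).+1}) : {poly int} :=
  \poly_(i < n) (if insub i is Some j then (f j)%:Z - D%:Z else 0).
pose rootsf (f : {ffun 'I_n -> 'I_(2 * D).+1}) : seq algC :=
  sval (closed_field_poly_normal (map_poly intr (polyf f))).
exists (flatten [seq rootsf f | f <- enum {: {ffun 'I_n -> 'I_(2 * D).+1}}]).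
move=> p nz_p size_p boundD x px0.
pose f : {ffun 'I_n -> 'I_(2 * D).+1} := [ffun i : 'I_n => inord `|(p`_i + D%:Z)%R|%N].
have eq_pf : polyf f = p.
  apply/polyP => i; rewrite coef_poly; case: ltnP => [lt_in | le_ni]; last first.
    by rewrite nth_default // (leq_trans size_p).
  rewrite insubT /= ffunE; have := boundD i; move: p`_i => z bound_z.
  by rewrite inordK /=; lia.
apply/flatten_mapP; exists f; first by rewrite mem_enum.
rewrite /rootsf eq_pf; case: (closed_field_poly_normal _) => rs /= eq_p.
move: px0; rewrite eq_p rootZ ?root_prod_XsubC // lead_coef_eq0.
by rewrite map_poly_eq0_id0 // intr_eq0 lead_coef_eq0.
Qed.

(** A permutation other than the identity with a nonzero term would never lower [d] and would raise
    it somewhere, although it preserves the sum of [d]. Ties in [d] are allowed. *)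
Lemma det_weight_triangular (R : comNzRingType) n (X : 'M[R]_n) (d : 'I_n -> nat) :
  (forall a b, X a b != 0 -> a = b \/ (d a < d b)%N) ->
  \det X = \prod_a X a a.
Proof.
move=> triX; rewrite /determinant (bigD1 1%g) //= odd_perm1 expr0 mul1r.
rewrite [X in _ + X]big1 ?addr0 => [|s ne_s1].
  by apply: eq_bigr => a _; rewrite perm1.
have [/existsP[a /eqP Xa0] | ] := boolP [exists a, X a (s a) == 0].
  by rewrite (bigD1 a) //= Xa0 mul0r mulr0.
rewrite negb_exists => /forallP nzX; case/negP: ne_s1; apply/eqP/permP => a.
rewrite perm1; case: (triX _ _ (nzX a)) => [// | lt_a].
have le_d b : (d b <= d (s b))%N by case: (triX _ _ (nzX b)) => [<-|/ltnW].
have: (\sum_b d b < \sum_b d (s b))%N.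
  rewrite (bigD1 a) //= [X in (_ < X)%N](bigD1 a) //= -addSn.
  by apply: leq_add => //; apply: leq_sum => b _.
by rewrite [X in (X < _)%N](reindex_inj (@perm_inj _ s)) ltnn.
Qed.

Lemma char_poly_conj (K : fieldType) n (P A : 'M[K]_n) : P \in unitmx ->
  char_poly (P *m A *m invmx P) = char_poly A.
Proof.
move=> uP; pose Px := map_mx polyC P; pose Qx := map_mx polyC (invmx P).
have PQ : Px *m Qx = 1%:M by rewrite -map_mxM mulmxV // map_mx1.
have -> : char_poly (P *m A *m invmx P) = \det (Px *m char_poly_mx A *m Qx).
  rewrite /char_poly /char_poly_mx mulmxBr mulmxBl !map_mxM.
  by rewrite scalar_mxC -(mulmxA 'X%:M) PQ mulmx1.
by rewrite !det_mulmx mulrAC -det_mulmx PQ det1 mul1r.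
Qed.

Lemma int_span_sum (V : zmodType) (I : Type) (s : seq I) (g : I -> V) (c : I -> int) :
  int_span [seq g i | i <- s] (\sum_(i <- s) g i *~ c i).
Proof.
elim: s => [|i s IHs] /=; first by rewrite big_nil.
by exists (c i); rewrite big_cons addrC addrA addNr add0r.
Qed.

Section WeightTriangularRepresentation.
Variables (R : realType) (G : groupType) (n : nat).
Variables (M : G -> 'M[int]_n) (P : 'M[algC]_n) (d : 'I_n -> nat).
Hypothesis MM : forall x y, M (x * y)%g = M x *m M y.
Hypothesis M1 : M 1%g = 1%:M.
Hypothesis injM : injective M.
Hypothesis unitP : P \in unitmx.

Let conjP (Z : 'M[int]_n) : 'M[algC]_n := P *m map_mx intr Z *m invmx P.
Let rho x := conjP (M x).
Hypothesis tri_rho : forall x a b, rho x a b != 0 -> a = b \/ (d a < d b)%N.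

Let conjPB Y Z : conjP (Y - Z) = conjP Y - conjP Z.
Proof. by rewrite /conjP map_mxB mulmxBr mulmxBl. Qed.

Let conjP1 : conjP 1%:M = 1%:M.
Proof. by rewrite /conjP map_mx1 mulmx1 mulmxV. Qed.

Let conjPM Y Z : conjP (Y *m Z) = conjP Y *m conjP Z.
Proof. by rewrite /conjP map_mxM !mulmxA mulmxKV. Qed.

Let rhoM x y : rho (x * y)%g = rho x *m rho y.
Proof. by rewrite /rho MM conjPM. Qed.

Let rho1 : rho 1%g = 1%:M.
Proof. by rewrite /rho M1. Qed.

Let rho_inj x : rho x = 1%:M -> x = 1%g.
Proof.
rewrite -conjP1 => /(congr1 (fun Z => invmx P *m Z *m P)).
rewrite /rho /conjP !mulmxA !mulmxKV // !mulVmx // !mul1mx => eqM.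
by apply: injM; rewrite M1; apply/matrixP => i j;
  have /matrixP/(_ i j) := eqM; rewrite !mxE => /intr_inj.
Qed.

Let tri0 x a b : a != b -> (d b <= d a)%N -> rho x a b = 0.
Proof.
move=> ne_ab le_ba; apply/eqP; apply: contraNT ne_ab => /tri_rho[-> //|].
by rewrite ltnNge le_ba.
Qed.

Let E x := rho x - 1%:M.

Let entryE x a b : E x a b = rho x a b - (a == b)%:R.
Proof. by rewrite /E; move: (rho x) => Z; rewrite !mxE. Qed.

Let EM x y : E (x * y)%g = E x + E y + E x *m E y.
Proof.
rewrite /E rhoM mulmxBl !mulmxBr !mul1mx mulmx1 opprB addrA addrACA.
by rewrite [_ - _ + (_ - _)]addrA subrK [RHS]addrC [X in _ = _ + X]addrC !addrA !subrK.
Qed.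

(** A descending filtration: stage 0 is the whole group by triangularity, stage 1 consists of the
    elements with unit diagonal, and the stage just above the largest weight is trivial. *)
Definition weight_kernel k x := forall a b, (d b < d a + k)%N -> E x a b = 0.

Let weight_kernel0 x : weight_kernel 0 x.
Proof.
move=> a b; rewrite addn0 => lt_ba; have ne_ab : a != b.
  by apply: contraTneq lt_ba => ->; rewrite ltnn.
by rewrite entryE (negPf ne_ab) tri0 ?subr0 // ltnW.
Qed.

Let EE0 k x y a b : weight_kernel k x -> (d b < d a + k)%N -> (E x *m E y) a b = 0.
Proof.
move=> kx lt_ba; rewrite mxE big1 // => c _.
have [lt_ca | le_ac] := ltnP (d c) (d a + k); first by rewrite kx ?mul0r.
by rewrite (@weight_kernel0 y c b) ?mulr0 // addn0 (leq_trans lt_ba).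
Qed.

Lemma weight_kernel_subgroup k : is_subgroup (weight_kernel k).
Proof.
split=> [a b _ | x y kx ky a b lt_ba | x kx a b lt_ba].
- by rewrite /E rho1 subrr mxE.
- by rewrite EM 2!mxE kx // ky // !add0r (EE0 _ kx).
have := EM x x^-1; rewrite mulgV {1}/E rho1 subrr => /matrixP/(_ a b).
by rewrite mxE [in RHS]mxE [in RHS]mxE kx // add0r (EE0 _ kx) // addr0.
Qed.

Let mask k (Z : 'M[algC]_n) : 'M[algC]_n :=
  \matrix_(a, b) (Z a b *+ (d b == d a + k)%N).

Let maskE k Z a b : mask k Z a b = Z a b *+ (d b == d a + k)%N.
Proof. by rewrite mxE. Qed.

(** For [x] and [y] in stage [k], the term [E x *m E y] raises the weight by more than [k], so the
    layer cut out by [mask k] is additive; its kernel is the next stage. As [M x - 1] is integral,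
    the layer is an integer combination of the masked conjugates of the elementary matrices. *)
Lemma weight_kernel_step k : (0 < k)%N ->
  cyclic_chain (weight_kernel k.+1) (weight_kernel k).
Proof.
move=> k_gt0; have -> : weight_kernel k.+1 =
    fun x => weight_kernel k x /\ mask k (E x) = 0.
  apply: boolp.funext => x; apply/boolp.propext; split=> [kx | [kx mx] a b].
    split=> [a b lt_ba | ]; first by apply: kx; rewrite addnS ltnW.
    apply/matrixP => a b; rewrite maskE [RHS]mxE.
    by case: eqP => [eq_ab|]; rewrite ?mulr0n // kx ?mul0rn // addnS eq_ab.
  rewrite addnS ltnS leq_eqVlt => /predU1P[eq_ab | /kx//].
  have /matrixP/(_ a b) := mx; rewrite maskE eq_ab eqxx mulr1n => ->.
  by rewrite mxE.
pose base (ij : 'I_n * 'I_n) := mask k (conjP (delta_mx ij.1 ij.2)).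
apply: (int_span_chain (e := [seq base ij | ij <- enum {: 'I_n * 'I_n}])).
- exact: weight_kernel_subgroup.
- move=> x y kx ky; apply/matrixP => a b; rewrite [RHS]mxE !maskE.
  case: eqP => [eq_ab|]; last by rewrite !mulr0n addr0.
  rewrite !mulr1n EM 2!mxE; suff -> : (E x *m E y) a b = 0 by rewrite addr0.
  rewrite mxE big1 // => c _.
  have [lt_ca | le_ac] := ltnP (d c) (d a + k); first by rewrite kx ?mul0r.
  by rewrite ky ?mulr0 // eq_ab; lia.
move=> x kx; suff -> : mask k (E x) =
  \sum_(ij <- enum {: 'I_n * 'I_n}) base ij *~ (M x - 1%:M) ij.1 ij.2.
  exact: int_span_sum.
rewrite big_enum /= /E -conjP1 -conjPB; move: (M x - 1%:M) => Z.
have base_entry a b i j : conjP (delta_mx i j) a b = P a i * invmx P j b.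
  rewrite /conjP map_delta_mx -(mul_delta_mx (0 : 'I_1) i j) mulmxA -colE -mulmxA -rowE.
  by rewrite mxE big_ord1 !mxE.
apply/matrixP => a b; rewrite summxE maskE.
under eq_bigr => ij _ do rewrite -scaler_int mxE maskE base_entry mulrnAr.
rewrite sumrMnl; congr (_ *+ _).
rewrite mxE -(pair_bigA _ (fun i j => (Z i j)%:~R * (P a i * invmx P j b))) exchange_big.
apply: eq_bigr => j _; rewrite mxE mulr_suml; apply: eq_bigr => i _.
by rewrite !mxE mulrA [P a i * _]mulrC.
Qed.

Lemma weight_kernel_chain k : cyclic_chain (weight_kernel k.+1) (weight_kernel 1).
Proof.
elim: k => [|k IHk]; first exact: cyclic_chain0.
exact: cyclic_chain_trans (weight_kernel_step (ltn0Sn k)) IHk.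
Qed.

Lemma weight_kernel_trivial :
  weight_kernel (\max_a d a).+1 = (fun x => x = 1%g).
Proof.
apply: boolp.funext => x; apply/boolp.propext; split=> [kx | -> a b _]; last first.
  by rewrite /E rho1 subrr mxE.
apply: rho_inj; apply/eqP; rewrite -subr_eq0; apply/eqP/matrixP => a b.
rewrite -/(E x) kx ?mxE // addnS ltnS (leq_trans (leq_bigmax b)) //.
exact: leq_addl.
Qed.

Let diagM x y a : rho (x * y)%g a a = rho x a a * rho y a a.
Proof.
rewrite rhoM mxE (bigD1 a) //= big1 ?addr0 // => c ne_ca.
have [le_ac | lt_ca] := leqP (d a) (d c); last first.
  by rewrite tri0 ?mul0r ?(ltnW lt_ca) // eq_sym.
by rewrite [rho y c a]tri0 ?mulr0.
Qed.

Let diag1 a : rho 1%g a a = 1.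
Proof. by rewrite rho1 mxE eqxx. Qed.

Let diag_neq0 x a : rho x a a != 0.
Proof.
apply/eqP => x0; have := diagM x x^-1%g a; rewrite mulgV diag1 x0 mul0r => /eqP.
by rewrite oner_eq0.
Qed.

Lemma weight_kernel1P x : weight_kernel 1 x <-> forall a, rho x a a = 1.
Proof.
split=> [kx a | x1 a b].
  have := kx a a; rewrite addn1 ltnS leqnn entryE eqxx => /(_ isT)/eqP.
  by rewrite subr_eq0 => /eqP.
rewrite addn1 ltnS entryE; have [<- _ | ne_ab le_ba] := eqVneq a b.
  by rewrite x1 subrr.
by rewrite tri0 ?subr0.
Qed.

(** The order on [algC] is only partial, so the absolute value is moved to the ordered field of real
    algebraic numbers before taking the logarithm. *)
Let log_abs a x : R := log2 R (in_algR (normr_real (rho x a a))).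

Let log_absM a x y : log_abs a (x * y)%g = log_abs a x + log_abs a y.
Proof.
rewrite /log_abs -log2M; last 2 first.
- by change (0 < `|rho x a a| :> algC); rewrite normr_gt0 diag_neq0.
- by change (0 < `|rho y a a| :> algC); rewrite normr_gt0 diag_neq0.
by congr log2; apply: val_inj; rewrite /= diagM normrM.
Qed.

Let log_abs1 a x : rho x a a = 1 -> log_abs a x = 0.
Proof.
move=> x1; have := log_absM a 1%g 1%g; rewrite mulg1 => eq1.
have -> : log_abs a x = log_abs a 1%g.
  by congr log2; apply: val_inj; rewrite /= x1 diag1.
by apply: (addrI (log_abs a 1%g)); rewrite -eq1 addr0.
Qed.

Let char_poly_rho x :
  map_poly intr (char_poly (M x)) =
  \prod_(c <- [seq rho x a a | a <- enum 'I_n]) ('X - c%:P).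
Proof.
rewrite map_char_poly -(char_poly_conj _ unitP) /char_poly.
rewrite (@det_weight_triangular _ _ _ d) => [|a b]; last first.
  rewrite -/(conjP (M x)) -/(rho x) /char_poly_mx.
  move: (tri_rho (x := x) (a := a) (b := b)).
  move: (rho x) => Z triZ; rewrite !mxE.
  have [-> | ne_ab] := eqVneq a b; first by left.
  by rewrite mulr0n sub0r oppr_eq0 polyC_eq0.
rewrite big_map big_enum; apply: eq_bigr => a _.
rewrite -/(conjP (M x)) -/(rho x) /char_poly_mx; move: (rho x) => Z.
by rewrite !mxE eqxx.
Qed.

(** The diagonal entries are the roots of the integral characteristic polynomial, whose coefficients
    are bounded through [C]. They lie in one finite list, and [code] records their positions in
    it. *)
Lemma bounded_diag_finite (C : nat) : exists s : seq G,
  forall x, (forall a, `|rho x a a| <= C%:R) ->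
  exists2 g, g \in s & forall a, rho g a a = rho x a a.
Proof.
have [D boundD] := coef_prod_XsubC_bounded algC n C.
have [rs rsP] := bounded_int_poly_roots n.+1 D.
have rho_rs x : (forall a, `|rho x a a| <= C%:R) -> forall a, rho x a a \in rs.
  move=> boundx a; apply: (rsP (char_poly (M x))).
  - exact/monic_neq0/char_poly_monic.
  - by rewrite size_char_poly.
  - move=> i; rewrite -(ler_nat algC) natr_absz intr_norm -coef_map_id0 //.
    rewrite char_poly_rho; apply: boundD; first by rewrite size_map size_enum_ord.
    by move=> _ /mapP[b _ ->].
  rewrite char_poly_rho root_prod_XsubC; apply: map_f.
  by rewrite mem_enum.
pose code x : {ffun 'I_n -> 'I_(size rs).+1} := [ffun a => inord (index (rho x a a) rs)].
have [s sP] := finite_image_seq code (fun x => forall a, `|rho x a a| <= C%:R).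
exists s => x boundx; have [g [sg boundg /ffunP eq_code]] := sP x boundx.
exists g => // a; have := congr1 val (eq_code a).
rewrite !ffunE /= !inordK ?ltnS ?index_size // => eq_index.
by rewrite -(nth_index 0 (rho_rs g boundg a)) eq_index nth_index ?rho_rs.
Qed.

Lemma weight_triangular_polycyclic : polycyclic G.
Proof.
apply: cyclic_chain_polycyclic; rewrite -weight_kernel_trivial.
apply: cyclic_chain_trans (weight_kernel_chain _) _.
pose L i x : R := if insub i is Some a then log_abs a x else 0.
apply: (finite_ball_chain (m := n) (L := L)).
- exact: weight_kernel_subgroup.
- by [].
- by [].
- move=> x y _ _; apply/weight_kernel1P => a.
  rewrite commgEl conjgE !diagM.
  have xV : rho x^-1%g a a * rho x a a = 1 by rewrite -diagM mulVg diag1.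
  have yV : rho y^-1%g a a * rho y a a = 1 by rewrite -diagM mulVg diag1.
  by rewrite [rho x a a * _]mulrC [rho y^-1%g a a * _]mulrA yV mul1r.
- move=> i x y lt_in _ _; rewrite /L insubT; exact: log_absM.
- move=> i x lt_in /weight_kernel1P x1; rewrite /L insubT; exact: log_abs1.
(* A logarithm at most [C] bounds the absolute value by [2 ^ C.+1], which is the radius to use for
   the diagonal entries. *)
move=> B; pose C := Num.bound `|B|.
have [s sP] := bounded_diag_finite (2 ^ C.+1)%N.
exists s => x _ boundx; have [|g sg eq_gx] := sP x.
  move=> a; have log_le : log_abs a x <= C%:R.
    apply: le_trans (ler_norm _) _; have := boundx a (ltn_ord a).
    rewrite /L valK => /le_trans; apply; apply: le_trans (ler_norm B) _.
    exact/ltW/archi_boundP/normr_ge0.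
  have rho_gt0 : 0 < in_algR (normr_real (rho x a a)).
    by change (0 < `|rho x a a| :> algC); rewrite normr_gt0 diag_neq0.
  have : `|rho x a a| <= algRval (2%:R ^+ C.+1) := log2_bound rho_gt0 log_le.
  by rewrite rmorphXn rmorph_nat natrX.
exists g => //; apply/weight_kernel1P => a.
by rewrite diagM -eq_gx -diagM mulVg diag1.
Qed.

End WeightTriangularRepresentation.

(** * Ping-pong *)

Lemma sum_ord2 (V : nmodType) (i : 'I_2) (F : 'I_2 -> V) :
  \sum_j F j = F i + F (rev_ord i).
Proof.
rewrite (bigD1 i) //= (bigD1 (rev_ord i)) /=; last first.
  by case: i => -[|[|//]] lt_i.
rewrite big1 ?addr0 // => j /andP[]; case: i j => -[|[|//]] ? [[|[|//]] ?] //.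
Qed.

Lemma ord2_neq (i j : 'I_2) : i != j -> j = rev_ord i.
Proof.
by case: i j => -[|[|//]] ? [[|[|//]] ?] // _; apply: val_inj.
Qed.

Section PingPong.
Variables (K : numFieldType) (H : groupType) (n : nat) (rho : H -> 'M[K]_n).
Variables (h : 'I_2 -> H) (v : 'I_2 -> 'rV[K]_n) (alpha : 'I_2 -> K).
Hypothesis rhoM : forall x y, rho (x * y)%g = rho x *m rho y.
Hypothesis rho1 : rho 1%g = 1%:M.
Hypothesis rho_h : forall i, v i *m rho (h i) = v i + alpha i *: v (rev_ord i).
Hypothesis rho_h' : forall i, v (rev_ord i) *m rho (h i) = v (rev_ord i).
Hypothesis v_free : forall x y : 'I_2 -> K,
  \sum_i x i *: v i = \sum_i y i *: v i -> x =1 y.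
Hypothesis alpha_ge3 : forall i, 3%:R <= `|alpha i|.

Lemma rho_letter i b (x : 'I_2 -> K) :
  (\sum_j x j *: v j) *m rho (eval_letter h (i, b)) =
  x i *: v i + (x (rev_ord i) + (-1) ^+ b * alpha i * x i) *: v (rev_ord i).
Proof.
rewrite (sum_ord2 i) mulmxDl -!scalemxAl /eval_letter /=.
have rhoVK w : w *m rho (h i) *m rho (h i)^-1%g = w.
  by rewrite -mulmxA -rhoM mulgV rho1 mulmx1.
have rho_hV' : v (rev_ord i) *m rho (h i)^-1%g = v (rev_ord i).
  by rewrite -[in LHS]rho_h' rhoVK.
case: b.
  have -> : v i *m rho (h i)^-1%g = v i - alpha i *: v (rev_ord i).
    apply/eqP; rewrite eq_sym subr_eq -{1}rho_hV' scalemxAl -mulmxDl -rho_h.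
    by rewrite rhoVK.
  rewrite rho_hV' expr1 mulN1r mulNr scalerBr scalerA scalerBl -addrA.
  by rewrite [- _ + _]addrC [x i * _]mulrC.
rewrite rho_h rho_h' expr0 mul1r scalerDr scalerA scalerDl -addrA.
by rewrite [X in _ + X]addrC [x i * _]mulrC.
Qed.

(* For [l = (i, b)]: coordinates of the image, under a positive power of [l],
   of a vector whose [i]-th coordinate dominates. *)
Definition ping_set (l : 'I_2 * bool) (x : 'I_2 -> K) := x l.1 != 0 /\
  exists m : nat, `|x (rev_ord l.1) - (-1) ^+ l.2 * alpha l.1 * m.+1%:R * x l.1|
                    <= `|x l.1|.

(** The multiplier of [x l.1] has absolute value at least 3, and the defect costs at most one. The
    coordinate of the other generator now dominates. *)
Lemma ping_set_lt l x : ping_set l x -> 2%:R * `|x l.1| <= `|x (rev_ord l.1)|.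
Proof.
case: l => i b [/= nz_x [m le_x]]; set c := _ * m.+1%:R in le_x.
have c_ge3 : 3%:R <= `|c|.
  rewrite !normrM normrX normrN1 expr1n mul1r normr_nat.
  by apply: le_trans (alpha_ge3 i) _; rewrite ler_peMr // ler1n.
have : `|c * x i| <= `|x (rev_ord i)| + `|x i|.
  rewrite -[c * x i](subKr (x (rev_ord i))); apply: le_trans (ler_normB _ _) _.
  by rewrite lerD2l.
rewrite normrM => le_c; rewrite -(lerD2r `|x i|); apply: le_trans le_c.
by rewrite -{2}[`|x i|]mul1r -mulrDl natr1 ler_wpM2r.
Qed.

(** The same generator must come with the same sign as the word is reduced, and then only the
    exponent grows; the other generator finds its own coordinate dominant by [ping_set_lt] and
    starts a new count. *)
Lemma ping_set_step l l' x : l' != inv_letter l -> ping_set l x ->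
  exists2 y, (\sum_j x j *: v j) *m rho (eval_letter h l') = \sum_j y j *: v j &
             ping_set l' y.
Proof.
case: l l' => i b [i' b'] ne_l Sx; have := ping_set_lt Sx.
case: Sx => /= nz_x [m le_x] lt_x.
pose y j := if j == i' then x i'
  else x (rev_ord i') + (-1) ^+ b' * alpha i' * x i'.
have ne_rev : (rev_ord i' == i') = false by case: (i') => -[|[|//]].
exists y; first by rewrite rho_letter (sum_ord2 i') /y eqxx ne_rev.
rewrite /ping_set /= /y eqxx ne_rev.
have [eq_i | ne_i] := eqVneq i i'.
  have eq_b : b' = b.
    move: ne_l; rewrite /inv_letter /= eq_i xpair_eqE eqxx /=.
    by case: (b) (b') => -[].
  rewrite -eq_i eq_b; split=> //; exists m.+1.
  suff -> : x (rev_ord i) + (-1) ^+ b * alpha i * x i -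
      (-1) ^+ b * alpha i * m.+2%:R * x i =
    x (rev_ord i) - (-1) ^+ b * alpha i * m.+1%:R * x i by [].
  rewrite -addrA; congr (_ + _); rewrite -[m.+2%:R]natr1 mulrDr mulr1 mulrDl.
  by rewrite opprD addrCA subrr addr0.
have eq_i' := ord2_neq ne_i; rewrite eq_i' rev_ordK in lt_x *.
have lt_x' : `|x i| < `|x (rev_ord i)|.
  apply: lt_le_trans lt_x; rewrite mulr_natl mulr2n ltrDl normr_gt0.
  exact: nz_x.
split; first by rewrite -normr_gt0; apply: le_lt_trans lt_x'.
by exists 0%N; rewrite mulr1 addrK ltW.
Qed.

Lemma ping_set_word l w x : path (fun y z => z != inv_letter y) l w ->
  ping_set l x ->
  exists2 y, (\sum_j x j *: v j) *m rho (\prod_(z <- w) eval_letter h z)%g =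
               \sum_j y j *: v j & ping_set (last l w) y.
Proof.
elim: w l x => [|l' w IHw] l x /=.
  by exists x => //; rewrite big_nil rho1 mulmx1.
case/andP=> ne_l path_w /(ping_set_step ne_l)[y eq_y /(IHw _ _ path_w)[z eq_z Sz]].
by exists z => //; rewrite big_cons rhoM mulmxA eq_y eq_z.
Qed.

Lemma fg_lift_pingpong_inj : injective (fg_lift h).
Proof.
have lift_one : fg_lift h 1%g = 1%g by rewrite /fg_lift big_nil.
suff ker1 u : fg_lift h u = 1%g -> u = 1%g.
  move=> u w eq_uw; apply: divg1_eq; apply: ker1.
  by rewrite fg_lift_is_multiplicative eq_uw -fg_lift_is_multiplicative mulgV.
case: u => -[|l w] red_w lift1; first exact: val_inj.
(* The vector with both coordinates 1 enters the ping set of any first letter. A nonempty reduced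
   word acting trivially would leave it in the ping set of the last letter, where [ping_set_lt]
   would give [2 <= 1]. *)
pose x (_ : 'I_2) : K := 1.
have [y eq_y Sy] : exists2 y, (\sum_j x j *: v j) *m rho (eval_letter h l) =
    \sum_j y j *: v j & ping_set l y.
  case: (l) => i b; pose y j := if j == i then 1 else 1 + (-1) ^+ b * alpha i.
  have ne_rev : (rev_ord i == i) = false by case: (i) => -[|[|//]].
  exists y; first by rewrite rho_letter (sum_ord2 i) /y eqxx ne_rev !mulr1.
  rewrite /ping_set /= /y eqxx ne_rev; split; first exact: oner_neq0.
  by exists 0%N; rewrite !mulr1 addrK.
have [z eq_z Sz] := ping_set_word red_w Sy.
have eq_x : x =1 z.
  apply: v_free; rewrite -eq_z -eq_y -mulmxA -rhoM.
  by move: lift1; rewrite /fg_lift /= big_cons => ->; rewrite rho1 mulmx1.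
have := ping_set_lt Sz; rewrite -!eq_x /x normr1 mulr1.
by rewrite -[1]/(1%:R) ler_nat.
Qed.

End PingPong.

(** * Divided differences and free subgroups *)

Section DividedDifference.
Variables (K : fieldType) (n' : nat).
Local Notation n := n'.+1.
Implicit Types (q : {poly K}) (T Z : 'M[K]_n) (x w : 'rV[K]_n) (f : 'cV[K]_n) (a : K).

(* [(q(X) - q(Y)) / (X - Y)], with [X] and [Y] acting on [Z] as left and right
   multiplication by [T]. *)
Definition divdiff q T Z : 'M[K]_n :=
  \sum_(k < size q) q`_k *: \sum_(i < k) (T ^+ (k.-1 - i) *m Z *m T ^+ i).

(** The commutator with [T] telescopes to [q(T) Z - Z q(T)]. *)
Lemma divdiff_comm q T Z :
  horner_mx T q *m Z = 0 -> Z *m horner_mx T q = 0 ->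
  T *m divdiff q T Z = divdiff q T Z *m T.
Proof.
move=> qZ0 Zq0; apply/eqP; rewrite -subr_eq0 mulmx_sumr mulmx_suml -sumrB.
have step (k : nat) c : T *m (c *: \sum_(i < k) (T ^+ (k.-1 - i) *m Z *m T ^+ i)) -
    (c *: \sum_(i < k) (T ^+ (k.-1 - i) *m Z *m T ^+ i)) *m T =
    (c *: T ^+ k) *m Z - Z *m (c *: T ^+ k).
  rewrite -scalemxAr -!scalemxAl -scalemxAr -!scalerBr; congr (_ *: _).
  rewrite mulmx_sumr mulmx_suml -sumrB.
  pose F i := T ^+ (k - i) *m Z *m T ^+ i.
  have -> : T ^+ k *m Z - Z *m T ^+ k = - (F k - F 0%N).
    by rewrite /F subnn subn0 !expr0 mul1mx mulmx1 opprB.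
  rewrite -telescope_sumr // big_mkord -sumrN; apply: eq_bigr => i _.
  rewrite opprB /F; have lt_ik := ltn_ord i; congr (_ - _).
    by rewrite !mulmxA -[T *m _]exprS; congr (T ^+ _ *m _ *m _); lia.
  by rewrite -mulmxA -[T ^+ i *m T]exprSr; congr (T ^+ _ *m _ *m _); lia.
under eq_bigr do rewrite step.
rewrite sumrB -mulmx_suml -mulmx_sumr.
have -> : \sum_(k < size q) q`_k *: T ^+ k = horner_mx T q.
  rewrite -[in RHS](coefK q) poly_def rmorph_sum; apply: eq_bigr => k _.
  by rewrite /= linearZ rmorphXn /= horner_mx_X.
by rewrite qZ0 Zq0 subr0.
Qed.

(** When [Z = f *m w], each [x T^j f] is a scalar, so multiplying the divided difference by [x]
    leaves a polynomial in [T] applied to [w]; this is that polynomial. *)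
Definition divdiff_coef q T x f : {poly K} :=
  \sum_(k < size q) q`_k *: \poly_(i < k) (x *m T ^+ (k.-1 - i) *m f) 0 0.

Lemma mul_divdiff q T x f w :
  x *m divdiff q T (f *m w) = w *m horner_mx T (divdiff_coef q T x f).
Proof.
rewrite mulmx_sumr rmorph_sum mulmx_sumr; apply: eq_bigr => k _ /=.
rewrite !linearZ /=; congr (_ *: _).
rewrite poly_def rmorph_sum mulmx_sumr mulmx_sumr; apply: eq_bigr => i _ /=.
rewrite !linearZ /= rmorphXn /= horner_mx_X !mulmxA.
by rewrite {1}[x *m _ *m f]mx11_scalar mul_scalar_mx -scalemxAl.
Qed.

(** The quotient of [q - q(a)] by [X - a], written as the divided difference at [X] and [a] so that
    it matches [divdiff_coef] term by term. *)
Definition divXsubC q a : {poly K} :=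
  \sum_(k < size q) q`_k *: \poly_(i < k) a ^+ (k.-1 - i).

Lemma divXsubC_spec q a : divXsubC q a * ('X - a%:P) = q - q.[a]%:P.
Proof.
rewrite -{2}(coefK q) poly_def horner_coef rmorph_sum -sumrB mulr_suml.
apply: eq_bigr => k _ /=; rewrite -scalerAl -mul_polyC polyCM -mulrBr mul_polyC.
congr (_ *: _); rewrite rmorphXn /= [RHS]subrXX mulrC; congr (_ * _).
rewrite poly_def (reindex_inj rev_ord_inj) /=; apply: eq_bigr => i _.
rewrite -rmorphXn /= mulrC mul_polyC.
have lt_ik := ltn_ord i; congr (_ ^+ _ *: _ ^+ _); lia.
Qed.

Lemma divdiff_coef_horner q T x f a :
  (divdiff_coef q T x f).[a] = (x *m horner_mx T (divXsubC q a) *m f) 0 0.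
Proof.
rewrite horner_sum rmorph_sum mulmx_sumr mulmx_suml summxE.
apply: eq_bigr => k _ /=; rewrite hornerZ linearZ /= -scalemxAr -scalemxAl mxE.
congr (_ * _); rewrite !poly_def horner_sum rmorph_sum mulmx_sumr mulmx_suml summxE.
rewrite (reindex_inj rev_ord_inj) /=; apply: eq_bigr => i _ /=.
rewrite linearZ /= rmorphXn /= horner_mx_X hornerZ hornerXn -scalemxAr -scalemxAl.
rewrite [RHS]mxE mulrC; have lt_ik := ltn_ord i.
by congr (_ ^+ _ * (x *m T ^+ _ *m f) 0 0); lia.
Qed.

Lemma horner_mx_eigen T x a (p : {poly K}) :
  x *m T = a *: x -> x *m horner_mx T p = p.[a] *: x.
Proof.
move=> xT; elim/poly_ind: p => [|p c IHp].
  by rewrite rmorph0 mulmx0 horner0 scale0r.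
rewrite rmorphD rmorphM /= horner_mx_X horner_mx_C mulmxDr mulmxA IHp.
by rewrite -scalemxAl xT scalerA mul_mx_scalar -scalerDl hornerMXaddC.
Qed.

Lemma divXsubC_eigen q T w a : root q a -> w *m horner_mx T q = 0 ->
  (w *m horner_mx T (divXsubC q a)) *m T = a *: (w *m horner_mx T (divXsubC q a)).
Proof.
move=> /rootP qa0 wq0; apply/eqP; rewrite -subr_eq0 -mul_mx_scalar -mulmxBr -mulmxA.
have -> : horner_mx T (divXsubC q a) *m (T - a%:M) =
    horner_mx T (divXsubC q a * ('X - a%:P)).
  by rewrite rmorphM rmorphB /= horner_mx_X horner_mx_C.
by rewrite divXsubC_spec qa0 subr0 wq0.
Qed.

End DividedDifference.

Lemma map_divdiff_coef (K L : fieldType) (phi : {rmorphism K -> L}) n' (q : {poly K})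
    (T : 'M_n'.+1) x f :
  map_poly phi (divdiff_coef q T x f) =
  divdiff_coef (map_poly phi q) (map_mx phi T) (map_mx phi x) (map_mx phi f).
Proof.
rewrite /divdiff_coef size_map_poly rmorph_sum; apply: eq_bigr => k _ /=.
rewrite linearZ /= coef_map; congr (_ *: _); apply/polyP => i.
rewrite coef_map !coef_poly; case: ifP => _; last by rewrite ?raddf0 /=.
by rewrite -rmorphXn -!map_mxM [RHS]mxE.
Qed.

(** * Minimal polynomials over the rationals *)

Section MinimalPolynomial.
Variable a : algC.

(** Evaluate at [a] a Bezout relation between [g] and the minimal polynomial [p]. They are coprime:
    the gcd does not vanish at [a], so its cofactor in [p] does, and minimality makes the gcd
    constant. *)
Lemma minCpoly_inverse (g : {poly rat}) : (map_poly ratr g).[a] != 0 ->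
  exists h : {poly rat}, (map_poly ratr h).[a] * (map_poly ratr g).[a] = 1.
Proof.
have [p [eq_p mon_p] rootp] := minCpolyP a.
move=> ga; have pa : root (map_poly ratr p) a by rewrite rootp.
have cop : coprimep p g.
  rewrite /coprimep; set d := gcdp p g.
  have /dvdpP[e eq_pe] : d %| p := dvdp_gcdl p g.
  have da : ~~ root (map_poly ratr d) a.
    rewrite rootp; apply: contra ga => /dvdp_trans/(_ (dvdp_gcdr p g)).
    by rewrite -rootp.
  have: root (map_poly ratr e) a.
    by move: pa; rewrite eq_pe rmorphM rootM (negPf da) orbF.
  rewrite rootp => /dvdp_leq le_pe.
  have nz_p := monic_neq0 mon_p.
  have [nz_e nz_d] : e != 0 /\ d != 0.
    by apply/andP; rewrite -negb_or -mulf_eq0 -eq_pe.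
  move: (le_pe nz_e); rewrite eq_pe size_mul //.
  by move: nz_e nz_d; rewrite -!size_poly_gt0; lia.
have /Bezout_coprimepP[[u v]] := cop; rewrite -size_poly_eq1 /=.
case/size_poly1P=> c nz_c eq_c.
exists (c^-1 *: v); have := congr1 (fun r => (map_poly ratr r).[a]) eq_c.
rewrite rmorphD !rmorphM /= hornerD !hornerM (rootP pa) mulr0 add0r map_polyC hornerC.
rewrite linearZ hornerZ /= fmorphV -mulrA => ->; rewrite mulVf // fmorph_eq0 //.
Qed.

(** This value is that of the derivative of the minimal polynomial, which is nonzero in
    characteristic 0 and of too small degree to vanish at [a]. *)
Lemma minCpoly_simple_root s : minCpoly a = s * ('X - a%:P) -> s.[a] != 0.
Proof.
have [p [eq_p mon_p] rootp] := minCpolyP a; have nz_p := monic_neq0 mon_p.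
move=> eq_s; have -> : s.[a] = (map_poly ratr p^`()).[a].
  rewrite -deriv_map -eq_p eq_s derivM derivXsubC hornerD hornerM hornerXsubC.
  by rewrite subrr mulr0 add0r mulr1.
have size_p : (1 < size p)%N by have := size_minCpoly a; rewrite eq_p size_map_poly.
have nz_p' : p^`() != 0.
  apply/eqP => /polyP/(_ (size p).-2); rewrite coef_deriv coef0.
  rewrite (_ : (size p).-2.+1 = (size p).-1); last by lia.
  move=> /eqP; rewrite mulrn_eq0 -/(lead_coef p) lead_coef_eq0 (negPf nz_p) orbF.
  by lia.
rewrite -[_ == _]/(root _ a) rootp; apply/negP => /(dvdp_leq nz_p').
by rewrite leqNgt lt_size_deriv.
Qed.

End MinimalPolynomial.

(** * The pairing on rational vectors attached to an eigenvalue *)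

Section RationalPairing.
Variables (n' : nat) (T : 'M[rat]_n'.+1) (q : {poly rat}) (a kappa : algC).
Local Notation n := n'.+1.
Local Notation TC := (map_mx ratr T : 'M[algC]_n).
Local Notation qC := (map_poly ratr q : {poly algC}).
Local Notation S := (horner_mx TC (divXsubC qC a)).

Definition pairing (w : 'rV[rat]_n) (f : 'cV[rat]_n) : algC :=
  (map_mx ratr w *m S *m map_mx ratr f) 0 0.

Lemma pairingE w f : pairing w f = (map_poly ratr (divdiff_coef q T w f)).[a].
Proof. by rewrite map_divdiff_coef divdiff_coef_horner. Qed.

Hypothesis qa0 : root qC a.

(** If [q(T)] kills [w], then [w S] is zero or an eigenvector for [a]. Hence [u(T)] acts on either
    side of the pairing as the scalar [u(a)], which lets rational vectors be combined with
    coefficients in the field generated by [a]. *)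
Lemma pairing_eigen (w : 'rV[rat]_n) (u : {poly rat}) (f : 'cV[algC]_n) :
  w *m horner_mx T q = 0 ->
  map_mx ratr w *m S *m horner_mx TC (map_poly ratr u) *m f =
  (map_poly ratr u).[a] *: (map_mx ratr w *m S *m f).
Proof.
move=> wq0; rewrite (horner_mx_eigen (a := a)) -?scalemxAl //.
apply: divXsubC_eigen => //; rewrite -map_horner_mx -map_mxM wq0 map_mx0 //.
Qed.

Lemma pairingBl w w' f : pairing (w - w') f = pairing w f - pairing w' f.
Proof. by rewrite /pairing map_mxB !mulmxBl [LHS]mxE [X in _ + X]mxE. Qed.

Lemma pairingBr w f f' : pairing w (f - f') = pairing w f - pairing w f'.
Proof. by rewrite /pairing map_mxB mulmxBr [LHS]mxE [X in _ + X]mxE. Qed.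

Lemma pairingMl w (u : {poly rat}) f : w *m horner_mx T q = 0 ->
  pairing (w *m horner_mx T u) f = (map_poly ratr u).[a] * pairing w f.
Proof.
move=> wq0; rewrite /pairing map_mxM map_horner_mx.
rewrite -(mulmxA (map_mx _ w)) -[_ *m S]rmorphM mulrC [X in _ *m X *m _]rmorphM mulmxA.
by rewrite pairing_eigen // [LHS]mxE.
Qed.

Lemma pairingMr w (u : {poly rat}) f : w *m horner_mx T q = 0 ->
  pairing w (horner_mx T u *m f) = (map_poly ratr u).[a] * pairing w f.
Proof.
move=> wq0; rewrite /pairing map_mxM map_horner_mx !mulmxA.
by rewrite pairing_eigen // [LHS]mxE.
Qed.

(** The vectors over [algC] show that the pairing has rank at least two on the rational kernels. One
    step of Gaussian elimination then gives dual pairs; its coefficients are values at [a] of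
    rational polynomials, so it is carried out on rational vectors by polynomials in [T]. *)
Lemma rational_dual_pairs (x1 x2 : 'rV[algC]_n) (y1 y2 : 'cV[algC]_n) :
  kappa != 0 ->
  x1 *m horner_mx TC qC = 0 -> x2 *m horner_mx TC qC = 0 ->
  horner_mx TC qC *m y1 = 0 -> horner_mx TC qC *m y2 = 0 ->
  x1 *m S *m y1 = kappa%:M -> x2 *m S *m y2 = kappa%:M ->
  x1 *m S *m y2 = 0 ->
  exists w1 w2 : 'rV[rat]_n, exists f1 f2 : 'cV[rat]_n,
   [/\ w1 *m horner_mx T q = 0 /\ w2 *m horner_mx T q = 0,
       horner_mx T q *m f1 = 0 /\ horner_mx T q *m f2 = 0,
       pairing w1 f1 != 0 /\ pairing w2 f2 != 0,
       pairing w1 f2 = 0 & pairing w2 f1 = 0].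
Proof.
move=> nz_kappa x1q x2q qy1 qy2 xy11 xy22 xy12.
(* The rows of [K1] and the columns of [K2] span the rational kernels of [q(T)], and still span them
   over [algC]. *)
pose Q := horner_mx T q; pose K1 := kermx Q; pose K2 := (kermx Q^T)^T.
have QC : horner_mx TC qC = map_mx ratr Q by rewrite map_horner_mx.
have K1Q i : row i K1 *m Q = 0 by apply: sub_kermxP; apply: row_sub.
have QK2 j : Q *m col j K2 = 0.
  apply: trmx_inj; rewrite trmx_mul tr_col trmxK trmx0.
  by apply: sub_kermxP; apply: row_sub.
have kerL x : x *m horner_mx TC qC = 0 -> exists c, x = c *m map_mx ratr K1.
  by rewrite QC => /sub_kermxP; rewrite -map_kermx => /submxP.
have kerR y : horner_mx TC qC *m y = 0 -> exists c, y = map_mx ratr K2 *m c.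
  rewrite QC => /(congr1 trmx); rewrite trmx_mul trmx0 map_trmx => /sub_kermxP.
  rewrite -map_kermx => /submxP[c eq_c]; exists c^T.
  by rewrite -[y]trmxK eq_c trmx_mul -map_trmx.
have [[c1 x1E] [c2 x2E]] := (kerL _ _ x1q, kerL _ _ x2q).
have [[d1 y1E] [d2 y2E]] := (kerR _ _ qy1, kerR _ _ qy2).
have [M [pairM cMd]] : exists M : 'M[algC]_n,
    (forall i j, pairing (row i K1) (col j K2) = M i j) /\
    (forall (c : 'rV_n) (d : 'cV_n),
       c *m map_mx ratr K1 *m S *m (map_mx ratr K2 *m d) = c *m M *m d).
  exists (map_mx ratr K1 *m S *m map_mx ratr K2); split=> [i j | c d].
    rewrite /pairing map_row map_col -row_mul colE mulmxA -row_mul -colE.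
    by rewrite [LHS]mxE [LHS]mxE.
  by rewrite !mulmxA.
rewrite x1E x2E y1E y2E !cMd in xy11 xy22 xy12.
have [/existsP[i /existsP[j nzM]] | ] :=
    boolP [exists i, exists j, M i j != 0]; last first.
  rewrite negb_exists => /forallP M0; case/eqP: nz_kappa.
  have M_eq0 : M = 0.
    apply/matrixP => i j; have := M0 i; rewrite negb_exists => /forallP/(_ j).
    by rewrite negbK => /eqP ->; rewrite [RHS]mxE.
  by move/matrixP/(_ 0 0): xy11; rewrite M_eq0 mulmx0 mul0mx !mxE eqxx.
(* If every minor through the pivot [M i j] vanishes, the form has rank one, so the product of the
   two diagonal values, [kappa ^+ 2], equals a product containing the zero value at [x1] and
   [y2]. *)
have [/existsP[k /existsP[l minor]] | ] :=
    boolP [exists k, exists l, M k l * M i j != M k j * M i l]; last first.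
  rewrite negb_exists => /forallP minor0; case/eqP: nz_kappa.
  have rank1 : M = (M i j)^-1 *: (col j M *m row i M).
    apply/matrixP => k l; have := minor0 k; rewrite negb_exists => /forallP/(_ l).
    rewrite negbK !mxE big_ord1 !mxE => /eqP <-.
    by rewrite mulrC mulfK.
  have cMdE c d : (c *m M *m d) 0 0 =
      (M i j)^-1 * ((c *m col j M) 0 0 * (row i M *m d) 0 0).
    rewrite {1}rank1 -scalemxAr -scalemxAl mxE -!mulmxA mulmxA.
    by rewrite [X in _ * X]mxE big_ord1.
  move/matrixP/(_ 0 0): xy11; move/matrixP/(_ 0 0): xy22; move/matrixP/(_ 0 0): xy12.
  rewrite !cMdE !mxE eqxx mulr1n.
  have key (r A B C D : algC) : r * (A * D) = 0 -> r * (B * D) = kappa ->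
      r * (A * C) = kappa -> kappa = 0.
    move=> e12 e22 e11; apply/eqP; rewrite -sqrf_eq0 expr2 -{1}e11 -e22.
    have -> : r * (A * C) * (r * (B * D)) = r * (A * D) * (r * (B * C)) by ring.
    by rewrite e12 mul0r.
  exact: key.
pose g1 := divdiff_coef q T (row i K1) (col j K2).
have g1a : (map_poly ratr g1).[a] = M i j by rewrite -pairingE pairM.
have [h ha] : exists h : {poly rat}, (map_poly ratr h).[a] * M i j = 1.
  by rewrite -g1a; apply: minCpoly_inverse; rewrite g1a.
(* At [a], the polynomials [u] and [v] take the elimination coefficients [M k j / M i j] and
   [M i l / M i j]. *)
pose u := h * divdiff_coef q T (row k K1) (col j K2).
pose v := h * divdiff_coef q T (row i K1) (col l K2).
have ua : (map_poly ratr u).[a] = (map_poly ratr h).[a] * M k j.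
  by rewrite rmorphM hornerM -pairingE pairM.
have va : (map_poly ratr v).[a] = (map_poly ratr h).[a] * M i l.
  by rewrite rmorphM hornerM -pairingE pairM.
have comQ (p : {poly rat}) : horner_mx T p *m Q = Q *m horner_mx T p.
  by rewrite -[LHS]rmorphM -[RHS]rmorphM mulrC.
have p21 : pairing (row k K1 - row i K1 *m horner_mx T u) (col j K2) = 0.
  by rewrite pairingBl pairingMl // !pairM ua mulrAC ha mul1r subrr.
have p12 : pairing (row i K1) (col l K2 - horner_mx T v *m col j K2) = 0.
  by rewrite pairingBr pairingMr // !pairM va mulrAC ha mul1r subrr.
exists (row i K1), (row k K1 - row i K1 *m horner_mx T u),
  (col j K2), (col l K2 - horner_mx T v *m col j K2).
split=> //.
- by rewrite mulmxBl -mulmxA comQ mulmxA !K1Q mul0mx subr0.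
- by rewrite mulmxBr mulmxA -comQ -mulmxA !QK2 mulmx0 subr0.
split; first by rewrite pairM.
rewrite pairingBl pairingMl // p12 mulr0 subr0 pairingBr pairingMr // !pairM va.
apply: contra minor; rewrite subr_eq0 => /eqP->; apply/eqP.
by rewrite -[RHS]mul1r -ha; ring.
Qed.

End RationalPairing.

(** * Jordan chains and their dual columns *)

Lemma jordan_form_unit (F : fieldType) n (A : 'M[F]_n) k (lam : 'I_k -> F) sz :
  jordan_form A lam sz -> exists (e : (\sum_i sz i)%N = n) (P : 'M[F]_n),
    P \in unitmx /\
    P *m A = castmx (e, e) (\mxdiag_i jordan_block (lam i) (sz i)) *m P.
Proof. by case=> _ [e [P uP /(similarP uP) PA]]; exists e, P. Qed.

(** [W i] and [V i] are the slices for block [i] of the rows of the base change matrix and of the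
    columns of its inverse, which makes them dual. *)
Lemma jordan_form_blocks (F : fieldType) n (A : 'M[F]_n) k (lam : 'I_k -> F) sz :
  jordan_form A lam sz ->
  exists (W : forall i, 'M[F]_(sz i, n)) (V : forall i, 'M[F]_(n, sz i)),
   [/\ forall i, W i *m A = jordan_block (lam i) (sz i) *m W i,
       forall i, A *m V i = V i *m jordan_block (lam i) (sz i),
       forall i, W i *m V i = 1%:M &
       forall i j, i != j -> W i *m V j = 0].
Proof.
case/jordan_form_unit=> e; case: n / e A => A [P [uP]]; rewrite castmx_id => PA.
set J := \mxdiag_i _ in PA.
pose U i : 'M[F]_(sz i, _) := submxcol 1%:M i.
pose C i : 'M[F]_(_, sz i) := submxrow 1%:M i.
have UJ i : U i *m J = jordan_block (lam i) (sz i) *m U i.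
  move: i; apply/eq_mxcolP; rewrite -mul_mxdiag_mxcol -mxcol_mul submxcolK.
  by rewrite mulmx1 mul1mx.
have JC i : J *m C i = C i *m jordan_block (lam i) (sz i).
  move: i; apply/eq_mxrowP; rewrite -mul_mxrow_mxdiag -mul_mxrow submxrowK.
  by rewrite mulmx1 mul1mx.
have UC i j : U i *m C j = submxblock 1%:M i j.
  by rewrite mul_submxrow mulmx1 submxblockEv.
have AP : A *m invmx P = invmx P *m J.
  by apply: (can_inj (mulKmx uP)); rewrite mulmxA PA mulmxK // mulKVmx.
exists (fun i => U i *m P), (fun i => invmx P *m C i); split=> [i | i | i | i j ne_ij].
- by rewrite -mulmxA PA mulmxA UJ -mulmxA.
- by rewrite mulmxA AP -mulmxA JC mulmxA.
- rewrite mulmxA mulmxK // UC; apply/matrixP => s t; rewrite !mxE.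
  by rewrite -val_eqE tagnat.eq_Rank eqxx.
- rewrite mulmxA mulmxK // UC; apply/matrixP => s t; rewrite !mxE.
  by rewrite -val_eqE tagnat.eq_Rank (negPf ne_ij).
Qed.

Section JordanChain.
Variables (F : fieldType) (n' m : nat) (A : 'M[F]_n'.+1) (a : F).
Local Notation n := n'.+1.
Variables (W : 'M[F]_(m.+1, n)) (V : 'M[F]_(n, m.+1)).
Hypothesis WA : W *m A = jordan_block a m.+1 *m W.
Hypothesis AV : A *m V = V *m jordan_block a m.+1.
Local Notation N := (jordan_block 0 m.+1 : 'M[F]_m.+1).
Local Notation first_row := (delta_mx 0 0 *m W : 'rV[F]_n).
Local Notation last_row := (delta_mx 0 ord_max *m W : 'rV[F]_n).
Local Notation last_col := (V *m delta_mx ord_max 0 : 'cV[F]_n).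

Lemma last_delta_jordan_block0 : delta_mx 0 ord_max *m N = 0 :> 'rV_m.+1.
Proof.
apply/matrixP => i j; rewrite mul_jordan_blockr mul0r add0r [RHS]mxE.
case: j => -[|s] lt_s //=; rewrite -[s]/(val (Ordinal (ltnW lt_s))) mxnthE mxE.
by rewrite -!val_eqE /= andbC; case: eqP => // eq_s; move: lt_s; rewrite eq_s ltnn.
Qed.

Lemma jordan_block0_nilpotent : N ^+ m.+1 = 0.
Proof.
apply/row_matrixP => i; rewrite row0 rowE -row0_jordan_block_exp -mulmxA.
have -> : N ^+ i *m N ^+ m.+1 = N ^+ m *m N *m N ^+ i.
  by rewrite -[LHS]exprD -[N ^+ m *m N]exprSr -[RHS]exprD addnC.
rewrite !mulmxA; have -> : N ^+ m = N ^+ (@ord_max m) by [].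
by rewrite row0_jordan_block_exp last_delta_jordan_block0 mul0mx.
Qed.

Lemma chain_shift t : W *m (A - a%:M) ^+ t = N ^+ t *m W.
Proof.
have WN : W *m (A - a%:M) = N *m W.
  by rewrite mulmxBr WA jordan_block_diag mulmxDl scalar_mxC addrC addKr.
elim: t => [|t IHt]; first by rewrite !expr0 mulmx1 mul1mx.
by rewrite exprS mulmxA WN -mulmxA IHt mulmxA -[N *m _]exprS.
Qed.

Lemma chain_shiftV t : (A - a%:M) ^+ t *m V = V *m N ^+ t.
Proof.
have NV : (A - a%:M) *m V = V *m N.
  by rewrite mulmxBl AV jordan_block_diag mulmxDr -scalar_mxC addrC addKr.
elim: t => [|t IHt]; first by rewrite !expr0 mulmx1 mul1mx.
by rewrite exprSr -mulmxA NV mulmxA IHt -mulmxA -[N ^+ t *m N]exprSr.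
Qed.

Lemma horner_mx_XsubC_exp t :
  horner_mx A (('X - a%:P) ^+ t) = (A - a%:M) ^+ t.
Proof. by rewrite rmorphXn rmorphB /= horner_mx_X horner_mx_C. Qed.

Variables (q s : {poly F}).
Hypothesis qE : q = ('X - a%:P) ^+ m.+1 * s.

Lemma first_row_annihilated : first_row *m horner_mx A q = 0.
Proof.
rewrite qE rmorphM /= mulmxA horner_mx_XsubC_exp -(mulmxA _ W) chain_shift.
by rewrite jordan_block0_nilpotent mul0mx mulmx0 mul0mx.
Qed.

Lemma last_col_annihilated : horner_mx A q *m last_col = 0.
Proof.
rewrite qE mulrC rmorphM /= -mulmxA (mulmxA _ V) horner_mx_XsubC_exp chain_shiftV.
by rewrite jordan_block0_nilpotent mulmx0 mul0mx mulmx0.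
Qed.

(** The quotient of [q] by [X - a] is [(X - a)^m s]. The power moves the first row of the chain to
    the last one, an eigenvector, on which [s] acts by [s(a)]. *)
Lemma first_row_divXsubC : first_row *m horner_mx A (divXsubC q a) = s.[a] *: last_row.
Proof.
have qa0 : q.[a] = 0 by rewrite qE hornerM horner_exp hornerXsubC subrr exprS !mul0r.
have -> : divXsubC q a = ('X - a%:P) ^+ m * s.
  apply: (mulIf (negbT (polyXsubC_eq0 a))); rewrite divXsubC_spec qa0 subr0 qE.
  by rewrite exprS -mulrA mulrC.
rewrite rmorphM /= mulmxA horner_mx_XsubC_exp -(mulmxA _ W) chain_shift mulmxA.
have -> : N ^+ m = N ^+ (@ord_max m) by [].
rewrite row0_jordan_block_exp; apply: horner_mx_eigen.
have := chain_shift 1; rewrite !expr1 => WN.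
apply/eqP; rewrite -subr_eq0 -mul_mx_scalar -mulmxBr -mulmxA WN mulmxA.
by rewrite last_delta_jordan_block0 mul0mx.
Qed.

End JordanChain.

(** * The integral centralizer *)

Lemma jordan_form_simple_commutant (F : fieldType) n (A X Y : 'M[F]_n) k
    (lam : 'I_k -> F) sz :
  jordan_form A lam sz -> injective lam ->
  A *m X = X *m A -> A *m Y = Y *m A -> X *m Y = Y *m X.
Proof.
case/jordan_form_unit=> e; case: n / e A X Y => A X Y [P [uP]].
rewrite castmx_id => PA inj_lam cX cY.
have conjP Z : A *m Z = Z *m A ->
    \mxdiag_i jordan_block (lam i) (sz i) *m (P *m Z *m invmx P) =
    P *m Z *m invmx P *m \mxdiag_i jordan_block (lam i) (sz i).
  move=> cZ; apply: (can_inj (mulmxK uP)).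
  rewrite -[RHS]mulmxA -PA [RHS]mulmxA mulmxKV // !mulmxA mulmxKV // -PA.
  by rewrite -[LHS]mulmxA cZ mulmxA.
have := simple_jordan_commutant_comm inj_lam (conjP X cX) (conjP Y cY).
rewrite !mulmxA !mulmxKV // => /(can_inj (mulmxKV uP)).
by rewrite -!mulmxA => /(can_inj (mulKmx uP)).
Qed.

Lemma jordan_form_weight (F : fieldType) n (A : 'M[F]_n) k (lam : 'I_k -> F) sz :
  jordan_form A lam sz ->
  (forall i j, i != j -> lam i = lam j -> sz i <> sz j) ->
  exists (P : 'M[F]_n) (d : 'I_n -> nat), P \in unitmx /\
    forall X, A *m X = X *m A -> forall a b, (P *m X *m invmx P) a b != 0 ->
      a = b \/ (d a < d b)%N.
Proof.
case/jordan_form_unit=> e; case: n / e A => A [P [uP]].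
rewrite castmx_id => PA ne_sz; exists P, (@jordan_weight k sz); split=> // X cX a b.
apply: (jordan_commutant_weight ne_sz).
apply: (can_inj (mulmxK uP)).
rewrite -[RHS]mulmxA -PA [RHS]mulmxA mulmxKV // !mulmxA mulmxKV // -PA.
by rewrite -[LHS]mulmxA cX mulmxA.
Qed.

Section Centralizer.
Variables (n : nat) (T : GL rat n).
Local Notation TC := (map_mx ratr (GLmx T) : 'M[algC]_n).
Implicit Types g h : int_centralizer T.

Definition centralizer_mx g : 'M[int]_n := GLmx (val g).

Lemma centralizer_mxM g h :
  centralizer_mx (g * h)%g = centralizer_mx g *m centralizer_mx h.
Proof. by []. Qed.

Lemma centralizer_mx1 : centralizer_mx 1%g = 1%:M.
Proof. by []. Qed.

Lemma centralizer_mx_inj : injective centralizer_mx.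
Proof. by move=> g h eq_gh; apply/val_inj/val_inj. Qed.

Lemma map_ratr_intr (Z : 'M[int]_n) :
  map_mx ratr (map_mx intr Z : 'M[rat]_n) = map_mx intr Z :> 'M[algC]_n.
Proof. by apply/matrixP => i j; rewrite !mxE ratr_int. Qed.

Lemma map_intr_inj (K : numDomainType) : injective (@map_mx int K intr n n).
Proof.
by move=> Y Z /matrixP eqYZ; apply/matrixP => i j; have := eqYZ i j;
  rewrite !mxE => /intr_inj.
Qed.

Lemma centralizer_mx_comm g :
  TC *m map_mx intr (centralizer_mx g) = map_mx intr (centralizer_mx g) *m TC.
Proof.
have /eqP cg : commutes_with T (val g) := valP g.
by rewrite -map_ratr_intr -!map_mxM cg.
Qed.

Variables (k : nat) (lam : 'I_k -> algC) (sz : 'I_k -> nat).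
Hypothesis jordanT : jordan_form TC lam sz.

Lemma simple_centralizer_abelian : injective lam -> forall g h, (g * h = h * g)%g.
Proof.
move=> inj_lam g h; apply: centralizer_mx_inj; rewrite !centralizer_mxM.
apply: (@map_intr_inj algC); rewrite !map_mxM.
by apply: (jordan_form_simple_commutant jordanT inj_lam); apply: centralizer_mx_comm.
Qed.

Lemma distinct_sizes_centralizer_polycyclic :
  (forall i j, i != j -> lam i = lam j -> sz i <> sz j) ->
  polycyclic (int_centralizer T).
Proof.
move=> ne_sz; have [P [d [uP triP]]] := jordan_form_weight jordanT ne_sz.
apply: (@weight_triangular_polycyclic Rdefinitions.R _ n centralizer_mx P d).
- exact: centralizer_mxM.
- exact: centralizer_mx1.
- exact: centralizer_mx_inj.
- exact: uP.
- by move=> g; apply/triP/centralizer_mx_comm.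
Qed.

End Centralizer.

(** * Unipotent elements of the integral centralizer *)

Lemma rat_mx_common_denominator m n (A : 'M[rat]_(m, n)) :
  exists (N : nat) (Z : 'M[int]_(m, n)), (0 < N)%N /\ N%:R *: A = map_mx intr Z.
Proof.
pose N := (\prod_(ij : 'I_m * 'I_n) `|denq (A ij.1 ij.2)|)%N.
exists N, (map_mx Num.floor (N%:R *: A)); split.
  by rewrite prodn_gt0 // => ij; rewrite absz_gt0.
apply/matrixP => i j; rewrite !mxE floorK //.
rewrite /N (bigD1 (i, j)) //= mulnC natrM -mulrA rpredM ?rpred_nat //.
have -> : (`|denq (A i j)|)%:R * A i j = (numq (A i j))%:~R.
  by rewrite natr_absz ger0_norm // mulrC numqE.
exact: intr_int.
Qed.

Lemma unipotent_unitmx (R : comUnitRingType) n' (A : 'M[R]_n'.+1) k :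
  A ^+ k = 0 -> 1%:M + A \in unitmx.
Proof.
case: k => [|k Ak0].
  by rewrite expr0 => /eqP; rewrite oner_eq0.
have := subrX1 (- A) k.+1; rewrite exprNn Ak0 mulr0 sub0r => /eqP.
rewrite -opprD mulNr eqr_opp eq_sym addrC => /eqP/mulmx1_unit[].
by [].
Qed.

Section DivdiffOverQ.
Variables (n' : nat) (T : 'M[rat]_n'.+1) (a : algC) (p : {poly rat}) (m : nat).
Local Notation n := n'.+1.
Local Notation q := (p ^+ m.+1).
Local Notation TC := (map_mx ratr T : 'M[algC]_n).
Local Notation S := (horner_mx TC (divXsubC (map_poly ratr q) a)).
Hypothesis rootp : forall g : {poly rat}, root (map_poly ratr g) a = (p %| g).

(** With [w D = w g(T)], the vanishing pairing says [g(a) = 0], so [p] divides [g] and [q] divides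
    [g ^+ m.+1], whence [w D ^+ m.+1 = 0]. One more factor [D] turns any row into [w] times a
    polynomial in [T]. *)
Lemma divdiff_nilpotent (w : 'rV[rat]_n) (f : 'cV[rat]_n) :
  w *m horner_mx T q = 0 -> horner_mx T q *m f = 0 ->
  pairing T q a w f = 0 -> divdiff q T (f *m w) ^+ m.+2 = 0.
Proof.
move=> wq0 qf0; rewrite pairingE => /eqP; rewrite -[_ == _]/(root _ a) rootp => dvd_p.
set D := divdiff _ _ _; set g := divdiff_coef _ _ _ _ in dvd_p.
have cD : comm_mx T D.
  by apply: divdiff_comm; [rewrite mulmxA qf0 mul0mx | rewrite -mulmxA wq0 mulmx0].
have wD t : w *m D ^+ t = w *m horner_mx T (g ^+ t).
  elim: t => [|t IHt]; first by rewrite !expr0 rmorph1.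
  rewrite exprSr mulmxA IHt -mulmxA [horner_mx _ _ *m D]comm_horner_mx //.
  by rewrite mulmxA mul_divdiff -/g -mulmxA -[_ *m horner_mx _ _]rmorphM -exprS.
have /dvdpP[r gr] : q %| g ^+ m.+1 by apply: dvdp_exp2r.
have wD0 : w *m D ^+ m.+1 = 0.
  by rewrite wD gr mulrC rmorphM mulmxA wq0 mul0mx.
apply/row_matrixP => i; rewrite row0 rowE exprS mulmxA mul_divdiff -mulmxA.
have cHD g' k : horner_mx T g' *m D ^+ k = D ^+ k *m horner_mx T g'.
  exact: (commrX k (comm_horner_mx g' cD)).
by rewrite cHD mulmxA wD0 mul0mx.
Qed.

(** The divided difference commutes with [T], so it moves past [S] and turns [w] into [w' g(T)]; on
    [w' S], which satisfies the eigenvector equation for [a], [g(T)] acts by [g(a)], the pairing of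
    [w] and [f]. *)
Lemma eigen_divdiff (w w' : 'rV[rat]_n) (f : 'cV[rat]_n) :
  w' *m horner_mx T q = 0 -> horner_mx T q *m f = 0 ->
  map_mx ratr w *m S *m map_mx ratr (divdiff q T (f *m w')) =
  pairing T q a w f *: (map_mx ratr w' *m S).
Proof.
move=> wq0 qf0; have cD : T *m divdiff q T (f *m w') = divdiff q T (f *m w') *m T.
  by apply: divdiff_comm; [rewrite mulmxA qf0 mul0mx | rewrite -mulmxA wq0 mulmx0].
have cDC : comm_mx TC (map_mx ratr (divdiff q T (f *m w'))).
  by rewrite /comm_mx -!map_mxM cD.
rewrite -mulmxA (comm_horner_mx _ cDC) mulmxA -map_mxM mul_divdiff map_mxM.
rewrite map_horner_mx -mulmxA -[_ *m S]rmorphM mulrC [X in _ *m X]rmorphM mulmxA.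
rewrite pairingE; apply: horner_mx_eigen; apply: divXsubC_eigen.
  by rewrite rootp exprS dvdp_mulIl.
by rewrite -map_horner_mx -map_mxM wq0 map_mx0.
Qed.

End DivdiffOverQ.

Lemma centralizer_unipotent n' (T : GL rat n'.+1) (A : 'M[rat]_n'.+1) (c : algC) k :
  GLmx T *m A = A *m GLmx T -> A ^+ k = 0 -> c != 0 ->
  exists (g : int_centralizer T) (s : nat),
    map_mx intr (centralizer_mx g) = 1%:M + s%:R *: A :> 'M[rat]_n'.+1 /\
    3%:R <= `|s%:R * c|.
Proof.
move=> cA nilA nz_c; have [N [Z [N_gt0 eqZ]]] := rat_mx_common_denominator A.
(* [N] clears the denominators, and [t] raises the transvection coefficient to the threshold 3 of
   ping-pong. *)
pose t := Num.bound (3%:R / `|c|); pose s := (t * N)%N.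
have eqsZ : map_mx intr (t%:R *: Z) = s%:R *: A :> 'M[rat]_n'.+1.
  rewrite natrM -scalerA eqZ; apply/matrixP => i j.
  by rewrite !mxE intrM rmorph_nat.
have nilZ : (t%:R *: Z) ^+ k = 0.
  apply: (@map_intr_inj _ rat); rewrite map_mx0 [LHS]rmorphXn /= eqsZ.
  by rewrite exprZn nilA scaler0.
have uZ := unipotent_unitmx nilZ.
have cg : commutes_with T (MkGL uZ).
  apply/eqP; rewrite /= map_mxD map_mx1 eqsZ mulmxDl mulmxDr mul1mx mulmx1.
  by rewrite -scalemxAl -scalemxAr cA.
exists (Sub (MkGL uZ) cg), s; split.
  by rewrite /centralizer_mx SubK /= map_mxD map_mx1 eqsZ.
have c_gt0 : 0 < `|c| by rewrite normr_gt0.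
rewrite normrM normr_nat -ler_pdivrMr // natrM.
apply: le_trans (ltW (archi_boundP _)) _; first by rewrite divr_ge0 ?ler0n.
by rewrite ler_peMr ?ler0n // ler1n.
Qed.

Lemma repeated_block_centralizer_free n' (T : GL rat n'.+1) k
    (lam : 'I_k -> algC) (sz : 'I_k -> nat) i j :
  jordan_form (map_mx ratr (GLmx T)) lam sz ->
  i != j -> lam i = lam j -> sz i = sz j ->
  exists f : {multiplicative free_group 'I_2 -> int_centralizer T}, injective f.
Proof.
move=> jordanT ne_ij eq_lam eq_sz; set a := lam i.
have [sz_gt0 _] := jordanT.
have [W [V [WA AV WV WV0]]] := jordan_form_blocks jordanT.
have [p [eq_p mon_p] rootp] := minCpolyP a.
have [s eq_s] : exists s, minCpoly a = s * ('X - a%:P).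
  by apply/factor_theorem/root_minCpoly.
have nz_s := minCpoly_simple_root eq_s.
have := WV0 i j ne_ij; have := (WV i, WV j); have := (WA i, WA j).
have := (AV i, AV j); move: (W i) (W j) (V i) (V j); rewrite -eq_lam -eq_sz -/a.
case: (sz i) (sz_gt0 i) => // m _ {WV0 WV WA AV W V} W1 W2 V1 V2.
move=> [AV1 AV2] [WA1 WA2] [WV1 WV2] WV12.
pose q := p ^+ m.+1.
have qE : map_poly ratr q = ('X - a%:P) ^+ m.+1 * s ^+ m.+1.
  by rewrite rmorphXn /= -eq_p eq_s exprMn mulrC.
have nz_sm : (s ^+ m.+1).[a] != 0 by rewrite horner_exp expf_neq0.
have qa0 : root (map_poly ratr q) a by rewrite rootp /q exprS dvdp_mulIl.
pose TC : 'M[algC]_n'.+1 := map_mx ratr (GLmx T).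
pose S := horner_mx TC (divXsubC (map_poly ratr q) a).
have delta11 : (delta_mx 0 ord_max : 'rV[algC]_m.+1) *m delta_mx ord_max 0 = 1%:M :> 'M_1.
  rewrite mul_delta_mx; apply/matrixP => r r'; rewrite !ord1 !mxE.
  by rewrite !eqxx.
have chain_pairing W' V' : W' *m TC = jordan_block a m.+1 *m W' ->
    delta_mx 0 0 *m W' *m S *m (V' *m delta_mx ord_max 0) =
    (s ^+ m.+1).[a] *: (delta_mx 0 ord_max *m (W' *m V') *m delta_mx ord_max 0)
      :> 'M[algC]_1.
  by move=> WA'; rewrite (first_row_divXsubC WA' qE) -scalemxAl !mulmxA.
(* The first row of each chain pairs with the last dual column of the same chain to [s(a) ^+ m.+1],
   nonzero as [a] is a simple root of its minimal polynomial, and the first chain pairs to zero with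
   the dual of the second. *)
have [||| w1 [w2 [f1 [f2 [[w1q w2q] [qf1 qf2] [nz11 nz22] p12 p21]]]]] :=
  rational_dual_pairs qa0 nz_sm
   (first_row_annihilated WA1 qE) (first_row_annihilated WA2 qE)
   (last_col_annihilated AV1 qE) (last_col_annihilated AV2 qE).
- by rewrite chain_pairing // WV1 mulmx1 delta11 scalemx1.
- by rewrite chain_pairing // WV2 mulmx1 delta11 scalemx1.
- by rewrite chain_pairing // WV12 mulmx0 mul0mx scaler0.
pose w (r : 'I_2) := if r == ord0 then w1 else w2.
pose f (r : 'I_2) := if r == ord0 then f1 else f2.
have rev_neq (r : 'I_2) : (rev_ord r == ord0) = (r != ord0).
  by case: r => -[|[|//]].
have wq r : w r *m horner_mx (GLmx T) q = 0 by rewrite /w; case: (r == ord0).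
have qf r : horner_mx (GLmx T) q *m f r = 0 by rewrite /f; case: (r == ord0).
have nz_diag r : pairing (GLmx T) q a (w r) (f r) != 0.
  by rewrite /w /f; case: (r == ord0).
have off_diag r : pairing (GLmx T) q a (w (rev_ord r)) (f r) = 0.
  by rewrite /w /f rev_neq; case: (r == ord0).
(* Crossing the indices makes [A r] send the eigenvector of [w r] to a multiple of the other one and
   kill that other one; the zero pairing of [w (rev_ord r)] with [f r] also makes it nilpotent. *)
pose A r := divdiff q (GLmx T) (f r *m w (rev_ord r)).
have [r | h hP] := fin_all_exists (P := fun r (g : int_centralizer T) =>
    exists N : nat, map_mx intr (centralizer_mx g) = 1%:M + N%:R *: A r
       :> 'M[rat]_n'.+1 /\ 3%:R <= `|N%:R * pairing (GLmx T) q a (w r) (f r)|).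
  apply: (centralizer_unipotent (k := m.+2)); last exact: nz_diag.
    apply: divdiff_comm; first by rewrite mulmxA qf mul0mx.
    by rewrite -mulmxA wq mulmx0.
  exact: (divdiff_nilpotent rootp (wq _) (qf _) (off_diag r)).
have [N NP] := fin_all_exists hP.
exists (fg_lift h).
pose v r := map_mx ratr (w r) *m S.
pose alpha r := (N r)%:R * pairing (GLmx T) q a (w r) (f r).
have v_A r r' : v r *m map_mx ratr (A r') =
    pairing (GLmx T) q a (w r) (f r') *: v (rev_ord r').
  exact: (eigen_divdiff rootp (w r) (wq _) (qf _)).
have v_h r r' : v r *m map_mx intr (centralizer_mx (h r')) =
    v r + ((N r')%:R * pairing (GLmx T) q a (w r) (f r')) *: v (rev_ord r').
  have [eq_h _] := NP r'; rewrite -map_ratr_intr eq_h map_mxD map_mx1 mulmxDr mulmx1.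
  congr (_ + _); rewrite -scalerA -v_A map_mxZ /= rmorph_nat -scalemxAr.
  by [].
apply: (@fg_lift_pingpong_inj algC _ _
  (fun g : int_centralizer T => map_mx intr (centralizer_mx g)) h v alpha).
- by move=> g g'; rewrite centralizer_mxM map_mxM.
- by rewrite centralizer_mx1 map_mx1.
- by move=> r; rewrite v_h.
- by move=> r; rewrite v_h off_diag mulr0 scale0r addr0.
(* Multiplying by [f r] on the right isolates coordinate [r], up to a nonzero factor. *)
- move=> x y eq_xy r.
  have coord z : ((\sum_l z l *: v l) *m map_mx ratr (f r)) 0 0 =
      z r * pairing (GLmx T) q a (w r) (f r).
    rewrite (sum_ord2 r) mulmxDl -!scalemxAl [LHS]mxE [X in X + _]mxE [X in _ + X]mxE.
    by rewrite -/(pairing _ _ _ (w (rev_ord r)) _) off_diag mulr0 addr0.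
  by apply: (mulIf (nz_diag r)); rewrite -!coord eq_xy.
- by move=> r; have [] := NP r.
Qed.

Theorem theorem1p1 (n : nat) (n_ge1 : (1 <= n)%N) (T : GL rat n)
    (k : nat) (lam : 'I_k -> algC) (sz : 'I_k -> nat)
    (T_jordan : jordan_form (map_mx ratr T) lam sz) :
  [/\ (forall i j : 'I_k, lam i = lam j -> i = j) ->
      (forall A B : int_centralizer T, (A * B = B * A)%g),
      (exists i j : 'I_k, [/\ i != j, lam i = lam j & sz i = sz j]) ->
      (exists f : {multiplicative free_group 'I_2 -> int_centralizer T},
         injective f)
    & (forall i j : 'I_k, i != j -> lam i = lam j -> sz i <> sz j) ->
      (exists i j : 'I_k, i != j /\ lam i = lam j) ->
      polycyclic (int_centralizer T)].
Proof.
split=> [inj_lam | [i [j [ne_ij eq_lam eq_sz]]] | ne_sz _].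
- exact: simple_centralizer_abelian T_jordan inj_lam.
- case: n n_ge1 T T_jordan => // n' _ T T_jordan.
  exact: repeated_block_centralizer_free T_jordan ne_ij eq_lam eq_sz.
- exact: distinct_sizes_centralizer_polycyclic T_jordan ne_sz.
Qed.
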